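(* Let $f:\mathbb{R}^n\to\mathbb{R}$ be differentiable with $L_f$-Lipschitz continuous gradient, let $g:\mathbb{R}^n\to\mathbb{R}\cup\{+\infty\}$ be proper, lower semicontinuous and $\gamma_g$-prox-bounded, assume $\operatorname{argmin}\varphi\neq\emptyset$ where $\varphi=f+g$, and let $x^\star$ be a critical point. Suppose $\nabla^2 f$ exists and is continuous around $x^\star$, and that $g$ is prox-regular at $x^\star$ for $-\nabla f(x^\star)$ and twice epi-differentiable at $x^\star$ for $-\nabla f(x^\star)$ with generalized quadratic second-order epi-derivative. Then for $\gamma>0$ sufficiently small, $$\big(\forall s\in\mathbb{R}^n:\ \mathrm d^2\varphi(x^\star,0)(s)\ge0\big)\iff\big(\forall s\in\mathbb{R}^n:\ \langle\nabla^2\varphi_\gamma(x^\star)s,s\rangle\ge0\big).$$ Consequently, $x^\star$ is a second-order stationary point of $\varphi$ if and only if it is a second-order stationary point of $\varphi_\gamma$.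
   Context: $\gamma_g$-prox-bounded: $g+\frac1{2\gamma}\|\cdot\|^2$ bounded below for each $\gamma\in(0,\gamma_g)$. $\operatorname{prox}_{\gamma g}(x)=\operatorname{argmin}_z\{g(z)+\frac1{2\gamma}\|z-x\|^2\}$; $x^\star$ is critical if $x^\star\in\operatorname{prox}_{\gamma g}(x^\star-\gamma\nabla f(x^\star))$ for some $\gamma\in(0,\gamma_g)$. Forward-backward envelope: $\varphi_\gamma(x)=\inf_u\{f(x)+\langle\nabla f(x),u-x\rangle+g(u)+\frac1{2\gamma}\|u-x\|^2\}$; under the hypotheses, $\varphi_\gamma$ is twice differentiable at $x^\star$ for small $\gamma$, and $\nabla^2\varphi_\gamma(x^\star)$ is its Hessian. Prox-regularity of $g$ at $\bar x$ for $\bar v\in\partial g(\bar x)$: there exist $r\ge0,\epsilon>0$ with $g(x')\ge g(x)+\langle v,x'-x\rangle-\frac r2\|x'-x\|^2$ for all $x'\in\mathcal B(\bar x;\epsilon)$ and all $(x,v)\in\operatorname{gph}\partial g$ with $\|x-\bar x\|<\epsilon$, $\|v-\bar v\|<\epsilon$, $g(x)\le g(\bar x)+\epsilon$. Twice epi-differentiability is in the sense of Rockafellar–Wets (Def. 13.6); the second-order epi-derivative is generalized quadratic if it has the form $s\mapsto\langle s,Ms\rangle+\delta_S(s)$ for a subspace $S$ and matrix $M$. $\mathrm d^2\varphi(\bar x,v)(w)$ is the second subderivative (Rockafellar–Wets Def. 13.3). A point $x^\star\in\operatorname{dom}\psi$ is a second-order stationary point of $\psi$ if $0\in\partial\psi(x^\star)$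 and $\mathrm d^2\psi(x^\star,0)(d)\ge0$ for all $d$ (for $C^2$ $\psi$: $\nabla\psi(x^\star)=0$, $\nabla^2\psi(x^\star)\succeq0$). *)

(* Defs.v *)
From HB Require Import structures.
From mathcomp Require Import all_boot all_order all_algebra.
From mathcomp Require Import all_classical reals constructive_ereal ereal.
Set Implicit Arguments. Unset Strict Implicit. Unset Printing Implicit Defensive.
Import Order.TTheory GRing.Theory Num.Theory.
Local Open Scope ring_scope.
Local Open Scope classical_set_scope.

Section Defs.
Variables (R : realType) (n : nat).
Local Notation vec := 'rV[R]_n.

Definition dot (u v : vec) : R := (u *m v^T) 0 0.
Definition enorm (u : vec) : R := Num.sqrt (dot u u).

Definition vconv (xs : nat -> vec) (x : vec) : Prop :=
  forall e : R, 0 < e -> exists N : nat, forall k, (N <= k)%N -> enorm (xs k - x) < e.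
Definition rconv (us : nat -> R) (u : R) : Prop :=
  forall e : R, 0 < e -> exists N : nat, forall k, (N <= k)%N -> `|us k - u| < e.

Definition HasGradient (F : vec -> R) (x v : vec) : Prop :=
  forall e : R, 0 < e -> exists d : R, 0 < d /\
    forall h : vec, enorm h < d -> `|F (x + h) - F x - dot v h| <= e * enorm h.

Definition HasDerivV (G : vec -> vec) (x : vec) (H : 'M[R]_n) : Prop :=
  forall e : R, 0 < e -> exists d : R, 0 < d /\
    forall h : vec, enorm h < d -> enorm (G (x + h) - G x - h *m H) <= e * enorm h.

Definition mx_continuous_at (Hf : vec -> 'M[R]_n) (y : vec) : Prop :=
  forall e : R, 0 < e -> exists d : R, 0 < d /\
    forall y' : vec, enorm (y' - y) < d -> forall i j, `|Hf y' i j - Hf y i j| < e.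

Definition proper_fun (psi : vec -> \bar R) : Prop :=
  (forall x, psi x != -oo%E) /\ exists x, psi x \is a fin_num.

Definition lsc (psi : vec -> \bar R) : Prop :=
  forall (x : vec) (t : R), (t%:E < psi x)%E ->
    exists d : R, 0 < d /\ forall y, enorm (y - x) < d -> (t%:E < psi y)%E.

Definition prox_bounded (g : vec -> \bar R) (gam_g : R) : Prop :=
  forall gam : R, 0 < gam -> gam < gam_g ->
    exists m : R, forall x, (m%:E <= g x + (enorm x ^+ 2 / (2 * gam))%:E)%E.

Definition is_prox (g : vec -> \bar R) (gam : R) (x z : vec) : Prop :=
  forall u : vec, (g z + (enorm (z - x) ^+ 2 / (2 * gam))%:E <=
                   g u + (enorm (u - x) ^+ 2 / (2 * gam))%:E)%E.

Definition critical (gradf : vec -> vec) (g : vec -> \bar R) (gam_g : R)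
  (xs : vec) : Prop :=
  exists gam : R, 0 < gam /\ gam < gam_g /\
    is_prox g gam (xs - gam *: gradf xs) xs.

Definition FBE (f : vec -> R) (gradf : vec -> vec) (g : vec -> \bar R)
  (gam : R) (x : vec) : \bar R :=
  ereal_inf (range (fun u : vec =>
    ((f x + dot (gradf x) (u - x) + enorm (u - x) ^+ 2 / (2 * gam))%:E + g u)%E)).

Definition reg_subgrad (psi : vec -> \bar R) (x v : vec) : Prop :=
  psi x \is a fin_num /\
  forall e : R, 0 < e -> exists d : R, 0 < d /\
    forall y, enorm (y - x) < d ->
      ((fine (psi x) + dot v (y - x) - e * enorm (y - x))%:E <= psi y)%E.

Definition subgrad (psi : vec -> \bar R) (x v : vec) : Prop :=
  psi x \is a fin_num /\
  exists (xk vk : nat -> vec),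
    vconv xk x /\ rconv (fun k => fine (psi (xk k))) (fine (psi x)) /\
    (forall k, reg_subgrad psi (xk k) (vk k)) /\ vconv vk v.

Definition prox_regular (g : vec -> \bar R) (xb vb : vec) : Prop :=
  subgrad g xb vb /\
  exists r e : R, 0 <= r /\ 0 < e /\
    forall x' x v : vec, enorm (x' - xb) <= e ->
      subgrad g x v -> enorm (x - xb) < e -> enorm (v - vb) < e ->
      (g x <= g xb + e%:E)%E ->
      (g x' >= g x + (dot v (x' - x) - r / 2 * enorm (x' - x) ^+ 2)%:E)%E.

Definition dq2 (psi : vec -> \bar R) (xb vb : vec) (tau : R) (w : vec) : \bar R :=
  ((psi (xb + tau *: w)%R - (fine (psi xb) + tau * dot vb w)%:E)
     * (2 / (tau ^+ 2))%:E)%E.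

(* Second subderivative d^2 psi(xb|vb)(wb)  (Rockafellar-Wets Def. 13.3):
   liminf_{tau \searrow 0, w -> wb} Delta^2_tau psi(xb|vb)(w) *)
Definition d2 (psi : vec -> \bar R) (xb vb wb : vec) : \bar R :=
  ereal_sup [set ereal_inf [set r | exists (tau : R) (w : vec),
                              0 < tau < d /\ enorm (w - wb) < d /\
                              r = dq2 psi xb vb tau w]
            | d in [set d : R | 0 < d]].

Definition liminf_ge (u : nat -> \bar R) (c : \bar R) : Prop :=
  forall t : R, (t%:E < c)%E -> exists N, forall k, (N <= k)%N -> (t%:E < u k)%E.
Definition limsup_le (u : nat -> \bar R) (c : \bar R) : Prop :=
  forall t : R, (c < t%:E)%E -> exists N, forall k, (N <= k)%N -> (u k < t%:E)%E.

(* Epi-convergence of the family Delta^2_tau psi(xb|vb) to phi as tau \searrow 0,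
   stated along every sequence tau_k \searrow 0 (Rockafellar-Wets Ch. 7) *)
Definition dq2_epi_converges (psi : vec -> \bar R) (xb vb : vec)
  (phi : vec -> \bar R) : Prop :=
  forall tk : nat -> R, (forall k, 0 < tk k) -> rconv tk 0 ->
  forall w : vec,
    (forall wk : nat -> vec, vconv wk w ->
       liminf_ge (fun k => dq2 psi xb vb (tk k) (wk k)) (phi w)) /\
    (exists wk : nat -> vec, vconv wk w /\
       limsup_le (fun k => dq2 psi xb vb (tk k) (wk k)) (phi w)).

Definition twice_epi_diff (psi : vec -> \bar R) (xb vb : vec) : Prop :=
  exists phi : vec -> \bar R, proper_fun phi /\ dq2_epi_converges psi xb vb phi.

(* The second-order epi-derivative d^2 psi(xb|vb) is generalized quadratic:
   s |-> <s, M s> + delta_S(s), S a linear subspace (row space of a matrix B) *)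
Definition generalized_quadratic (q : vec -> \bar R) : Prop :=
  exists (M B : 'M[R]_n), forall s : vec,
    q s = if (s <= B)%MS then (dot s (s *m M^T))%:E else +oo%E.

Definition hessian_at (psi : vec -> \bar R) (x : vec) (H : 'M[R]_n) : Prop :=
  exists r : R, 0 < r /\ exists G : vec -> vec,
    (forall y, enorm (y - x) < r ->
       psi y \is a fin_num /\ HasGradient (fun z => fine (psi z)) y (G y)) /\
    HasDerivV G x H.

Definition sosp (psi : vec -> \bar R) (x : vec) : Prop :=
  psi x \is a fin_num /\ subgrad psi x 0 /\ forall d : vec, (0 <= d2 psi x 0 d)%E.

End Defs.

(* Main.v *)
Require Import Defs.
From HB Require Import structures.
From mathcomp Require Import all_boot all_order all_algebra.
From mathcomp Require Import all_classical reals constructive_ereal ereal.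
From mathcomp Require Import topology normedtype sequences derive.
From mathcomp Require Import ring lra.
Set Implicit Arguments. Unset Strict Implicit. Unset Printing Implicit Defensive.
Import Order.TTheory GRing.Theory Num.Theory.
Import numFieldNormedType.Exports.
Local Open Scope ring_scope.

(* Criticality gives the global minorant
     g u >= g xs - <grad f(xs), u - xs> - |u - xs|^2 / (2 gam0),
   so for gam < gam0 every x has a minimizer T x of the forward-backward objective,
   with |T x - xs| = O(|x - xs|) and T xs = xs.  Prox-regularity makes T Lipschitz near
   xs, hence the envelope is differentiable there with gradient
   (x - T x)(1/gam - Hf(x)^T).  Rescaling the minimization that defines T along
   x = xs + tau s and letting tau -> 0, epi-convergence of the difference quotients of g
   to q(u) = <u, M u> + delta_S(u) forces the limit points of (T x - xs) / tau to minimize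
   q(u) + 2 <A s, u> + |u - s|^2 / gam, where A = Hf(xs).  The minimizer is unique and
   linear in s, so T is differentiable at xs and the Hessian H of the envelope satisfies
     <H s, s> = min_u q(u) + 2 <A s, u> + |u - s|^2 / gam - <A s, s>.
   Nonnegativity of this form for all s is equivalent to that of q + A, which is the
   second subderivative of f + g at (xs, 0). *)

(** * Euclidean geometry of row vectors *)

Section Euclidean.
Variables (R : realType) (n : nat).
Implicit Types (u v w : 'rV[R]_n) (A : 'M[R]_n).

Lemma dotE u v : dot u v = \sum_i u 0 i * v 0 i.
Proof. by rewrite /dot mxE; apply: eq_bigr => i _; rewrite mxE. Qed.

Lemma dotC u v : dot u v = dot v u.
Proof. by rewrite !dotE; apply: eq_bigr => i _; rewrite mulrC. Qed.

Lemma dotDl u v w : dot (u + v) w = dot u w + dot v w.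
Proof. by rewrite /dot mulmxDl mxE. Qed.

Lemma dotNl u v : dot (- u) v = - dot u v.
Proof. by rewrite /dot mulNmx mxE. Qed.

Lemma dotZl a u v : dot (a *: u) v = a * dot u v.
Proof. by rewrite /dot -scalemxAl mxE. Qed.

Lemma dotDr u v w : dot w (u + v) = dot w u + dot w v.
Proof. by rewrite dotC dotDl !(dotC w). Qed.

Lemma dotNr u v : dot u (- v) = - dot u v.
Proof. by rewrite dotC dotNl dotC. Qed.

Lemma dotZr a u v : dot u (a *: v) = a * dot u v.
Proof. by rewrite dotC dotZl dotC. Qed.

Lemma dot0l u : dot 0 u = 0.
Proof. by rewrite /dot mul0mx mxE. Qed.

Lemma dot0r u : dot u 0 = 0.
Proof. by rewrite dotC dot0l. Qed.

Definition dot_linE := (dotDl, dotDr, dotNl, dotNr, dotZl, dotZr, dot0l, dot0r).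

Lemma dot_mulmx u v A : dot (u *m A) v = dot u (v *m A^T).
Proof. by rewrite /dot trmx_mul trmxK mulmxA. Qed.

Lemma dot_ge0 u : 0 <= dot u u.
Proof. by rewrite dotE sumr_ge0 // => i _; rewrite -expr2 sqr_ge0. Qed.

Lemma enorm_ge0 u : 0 <= enorm u.
Proof. exact: sqrtr_ge0. Qed.

Lemma enorm_sqr u : enorm u ^+ 2 = dot u u.
Proof. by rewrite sqr_sqrtr ?dot_ge0. Qed.

Lemma enorm0 : enorm (0 : 'rV[R]_n) = 0.
Proof. by rewrite /enorm dot0l sqrtr0. Qed.

Lemma enormZ a u : enorm (a *: u) = `|a| * enorm u.
Proof.
by rewrite /enorm dotZl dotZr mulrA -expr2 sqrtrM ?sqr_ge0 // sqrtr_sqr.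
Qed.

Lemma enormN u : enorm (- u) = enorm u.
Proof. by rewrite -scaleN1r enormZ normrN1 mul1r. Qed.

Lemma enormBC u v : enorm (u - v) = enorm (v - u).
Proof. by rewrite -opprB enormN. Qed.

Lemma ler_coord_enorm u i : `|u 0 i| <= enorm u.
Proof.
rewrite -ler_sqr ?nnegrE ?enorm_ge0 // enorm_sqr dotE real_normK ?num_real //.
rewrite (bigD1 i) //= -expr2 lerDl sumr_ge0 // => j _.
by rewrite -expr2 sqr_ge0.
Qed.

Lemma enorm_eq0 u : enorm u = 0 -> u = 0.
Proof.
move=> u0; apply/rowP => i; rewrite mxE; apply/eqP.
by rewrite -normr_le0 -u0 ler_coord_enorm.
Qed.

(** Cauchy-Schwarz: the squared norm of |v|^2 u - <u, v> v equals |v|^2 times the gap |u|^2 |v|^2 -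
    <u, v>^2. *)
Lemma norm_dot_le u v : `|dot u v| <= enorm u * enorm v.
Proof.
have [/enorm_eq0 ->|v0] := eqVneq (enorm v) 0.
  by rewrite dot0r enorm0 mulr0 normr0.
have vp : 0 < enorm v by rewrite lt_def v0 enorm_ge0.
rewrite -ler_sqr ?nnegrE ?mulr_ge0 ?enorm_ge0 // real_normK ?num_real //.
rewrite exprMn.
have := dot_ge0 (enorm v ^+ 2 *: u - dot u v *: v).
rewrite !dot_linE -!enorm_sqr (dotC v u) => h.
rewrite -subr_ge0 -(pmulr_rge0 _ (exprn_gt0 2 vp)).
by apply: le_trans h _; rewrite le_eqVlt; apply/orP; left; apply/eqP; ring.
Qed.

Lemma dot_ler u v : dot u v <= enorm u * enorm v.
Proof. exact: le_trans (ler_norm _) (norm_dot_le u v). Qed.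

Lemma enormD u v : enorm (u + v) <= enorm u + enorm v.
Proof.
rewrite -ler_sqr ?nnegrE ?addr_ge0 ?enorm_ge0 // enorm_sqr !dot_linE -!enorm_sqr.
by have := dot_ler u v; rewrite (dotC v u); nra.
Qed.

Lemma enormB u v : enorm (u - v) <= enorm u + enorm v.
Proof. by rewrite -(enormN v) enormD. Qed.

Lemma enorm_le_sum u : enorm u <= \sum_i `|u 0 i|.
Proof.
rewrite -ler_sqr ?nnegrE ?enorm_ge0 ?sumr_ge0 // enorm_sqr dotE expr2 mulr_suml.
apply: ler_sum => i _; apply: le_trans (ler_norm _) _; rewrite normrM.
by rewrite ler_wpM2l // (bigD1 i) //= lerDl sumr_ge0.
Qed.

(** A crude substitute for the operator norm: it is invariant under transposition and is controlled
    by the entrywise continuity in [mx_continuous_at]. *)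
Definition mx_l1 A : R := \sum_j \sum_i `|A i j|.

Lemma mx_l1_ge0 A : 0 <= mx_l1 A.
Proof. by apply: sumr_ge0 => j _; apply: sumr_ge0. Qed.

Lemma enorm_mulmx u A : enorm (u *m A) <= mx_l1 A * enorm u.
Proof.
apply: le_trans (enorm_le_sum _) _; rewrite mulr_suml; apply: ler_sum => j _.
rewrite mxE; apply: le_trans (ler_norm_sum _ _ _) _; rewrite mulr_suml.
apply: ler_sum => i _; rewrite normrM mulrC ler_wpM2l //.
exact: ler_coord_enorm.
Qed.

Lemma mx_l1_tr A : mx_l1 A^T = mx_l1 A.
Proof.
rewrite /mx_l1 exchange_big; apply: eq_bigr => j _; apply: eq_bigr => i _.
by rewrite mxE.
Qed.

Lemma mx_l1_continuous (Hf : 'rV[R]_n -> 'M[R]_n) y e :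
  mx_continuous_at Hf y -> 0 < e -> exists2 d : R, 0 < d &
  forall y', enorm (y' - y) < d -> mx_l1 (Hf y' - Hf y) <= e.
Proof.
(* The denominator exceeds the number of entries; the added 1 keeps it positive when [n] is 0. *)
move=> Hc e0; have e'0 : 0 < e / (n%:R * n%:R + 1).
  by apply: divr_gt0 => //; rewrite ltr_wpDl // mulr_ge0 ?ler0n.
have [d [d0 hd]] := Hc _ e'0; exists d => // y' /hd h.
apply: le_trans (_ : \sum_(j < n) \sum_(i < n) (e / (n%:R * n%:R + 1)) <= _).
  apply: ler_sum => j _; apply: ler_sum => i _.
  by rewrite !mxE; exact: ltW (h i j).
have p : 0 < (n%:R * n%:R + 1 : R) by rewrite ltr_wpDl // mulr_ge0 ?ler0n.
rewrite !sumr_const !card_ord -mulrnA -[_ *+ (n * n)]mulr_natr natrM.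
rewrite -mulrA ler_piMr ?ltW //.
by rewrite mulrC ltr_pdivrMr // mul1r ltrDl.
Qed.

End Euclidean.

(** * Mean value theorem along segments and sequential compactness *)

Section Analysis.
Local Open Scope classical_set_scope.
Local Open Scope ring_scope.
Variables (R : realType) (n : nat).
Local Notation vec := 'rV[R]_n.

Lemma is_derive_eps (p : R -> R) (t a : R) :
  (forall e, 0 < e -> exists d, 0 < d /\
     forall s, `|s| < d -> `|p (t + s) - p t - s * a| <= e * `|s|) ->
  is_derive t 1 p a.
Proof.
move=> H.
have cv : (fun h : R => h^-1 *: (p (h *: 1 + t) - p t)) @ 0^' --> a.
  apply/cvgrPdist_le => /= e e0; have [d [d0 hd]] := H e e0.
  near=> h.
  have h0 : h != 0 by near: h; exact: nbhs_dnbhs_neq.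
  have hlt : `|h| < d by near: h; apply: dnbhs0_lt.
  have := hd _ hlt; rewrite -[h *: 1]/(h * 1) mulr1 (addrC h) => hh.
  rewrite -[_ *: _]/(h^-1 * _).
  have -> : a - h^-1 * (p (t + h) - p t) = - (h^-1 * (p (t + h) - p t - h * a)).
    by field.
  by rewrite normrN normrM normfV mulrC ler_pdivrMr // normr_gt0.
apply: DeriveDef; first by apply/cvg_ex; exists a.
exact: cvg_lim cv.
Unshelve. all: by end_near.
Qed.

(** One-variable mean value theorem for t |-> F (x + t h), whose derivative is <G (x + t h), h>. *)
Lemma mvt_along_segment (F : vec -> R) (G : vec -> vec) (x h : vec) :
  (forall t, 0 <= t <= 1 -> HasGradient F (x + t *: h) (G (x + t *: h))) ->
  exists2 c, 0 <= c <= 1 & F (x + h) - F x = dot (G (x + c *: h)) h.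
Proof.
move=> HG; pose p t := F (x + t *: h).
have dp (t : R) : 0 <= t <= 1 -> is_derive t 1 p (dot (G (x + t *: h)) h).
  move=> t01; apply: is_derive_eps => e e0.
  have hp : 0 < enorm h + 1 by rewrite ltr_wpDl ?enorm_ge0.
  have [d [d0 hd]] := HG t t01 (e / (enorm h + 1)) (divr_gt0 e0 hp).
  exists (d / (enorm h + 1)); split; first exact: divr_gt0.
  move=> s; rewrite ltr_pdivlMr // => sd.
  have sh : enorm (s *: h) <= `|s| * (enorm h + 1).
    by rewrite enormZ ler_wpM2l // lerDl.
  have := hd _ (le_lt_trans sh sd); rewrite dotZr -(addrA x) -scalerDl => H.
  apply: le_trans H _; apply: le_trans (ler_wpM2l _ sh) _.
    by apply/ltW/divr_gt0.
  by rewrite mulrCA divfK ?gt_eqF // mulrC.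
have pc : {within `[0, 1]%classic, continuous p}.
  apply: derivable_within_continuous => t; rewrite in_itv /= => /dp dpt.
  exact: ex_derive.
have [c] := @MVT R p (fun t => dot (G (x + t *: h)) h) 0 1 ltr01
  (fun t ht => dp t (subset_itv_oo_cc ht)) pc.
rewrite in_itv /= => /andP[c0 c1]; rewrite /p scale1r scale0r addr0 subr0 mulr1.
by exists c; rewrite ?ltW.
Qed.

Lemma bounded_cluster (u : nat -> vec) (M : R) :
  (forall k, enorm (u k) <= M) ->
  exists l, forall e N, 0 < e -> exists2 k, (N <= k)%N & enorm (u k - l) < e.
Proof.
move=> uM.
have cA : compact [set v : vec | forall i, `[- M, M]%classic (v ord0 i)].
  by apply: (@rV_compact _ _ (fun=> `[- M, M]%classic)) => i; exact: segment_compact.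
have [|l [_ cl]] := cA (u @ \oo)%classic _.
  exists 0 => // k _ i /=; rewrite in_itv /= -ler_norml.
  exact: le_trans (ler_coord_enorm _ _) (uM k).
exists l => e N e0.
(* The ambient topology is that of the sup norm: [n] coordinates of size at most e / (n + 1) give a
   Euclidean norm below [e]. *)
have e'0 : 0 < e / (n%:R + 1) by rewrite divr_gt0 // ltr_wpDl.
have [||w [[k Nk <-] /= bw]] := cl [set u k | k in [set k | (N <= k)%N]]%classic
  (ball l (e / (n%:R + 1))).
- by exists N => // k /= Nk; exists k.
- exact: nbhsx_ballx.
exists k => //.
apply: le_lt_trans (enorm_le_sum _) _.
apply: le_lt_trans (_ : \sum_(i < n) e / (n%:R + 1) < _).
  apply: ler_sum => i _; rewrite !mxE distrC.
  by have := ltW (bw.2 ord0 i).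
rewrite sumr_const card_ord -(mulr_natr (e / _)) -mulrA gtr_pMr //.
by rewrite mulrC ltr_pdivrMr ?ltr_wpDl // mul1r ltrDl.
Qed.

Lemma rconv_inv : rconv (fun k => k.+1%:R^-1 : R) 0.
Proof.
move=> e e0.
exists (Num.truncn e^-1) => k Nk.
rewrite subr0 ger0_norm ?invr_ge0 // invf_plt ?posrE //.
apply: lt_le_trans (truncnS_gt _) _.
by rewrite ler_nat ltnS.
Qed.

(** The extraction [s] satisfies only [k <= s k] instead of strict monotonicity; this already makes
    limits pass to the extracted sequence. *)
Lemma BolzanoWeierstrass (u : nat -> vec) (M : R) :
  (forall k, enorm (u k) <= M) ->
  exists l (s : nat -> nat), (forall k, (k <= s k)%N) /\ vconv (u \o s) l.
Proof.
move=> /bounded_cluster[l hl]; exists l.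
have /choice[s hs] : forall k, exists m, (k <= m)%N /\ enorm (u m - l) < k.+1%:R^-1.
  by move=> k; have [|m] := hl k.+1%:R^-1 k; [rewrite invr_gt0|exists m].
exists s; split=> [k|e /rconv_inv[N hN]]; first by case: (hs k).
exists N => k /hN; rewrite subr0 ger0_norm ?invr_ge0 //.
exact: lt_trans (hs k).2.
Qed.

End Analysis.

(** * Limits and second-order Taylor expansions *)

Section Sequences.
Variables (R : realType) (n : nat).
Local Notation vec := 'rV[R]_n.
Local Open Scope classical_set_scope.
Local Open Scope ring_scope.

Lemma rconvP (u : nat -> R) l : rconv u l <-> u @ \oo --> l.
Proof.
split=> [H|/cvgrPdist_lt H e e0].
  apply/cvgrPdist_lt => e e0; have [N hN] := H e e0.
  by exists N => // k /= Nk; rewrite distrC; exact: hN.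
have [N _ hN] := H e e0; exists N => k Nk.
by rewrite distrC; exact: hN.
Qed.

Lemma rconvD (u v : nat -> R) l m :
  rconv u l -> rconv v m -> rconv (fun k => u k + v k) (l + m).
Proof. by move=> /rconvP hu /rconvP hv; apply/rconvP; exact: cvgD. Qed.

Lemma rconvM (u v : nat -> R) l m :
  rconv u l -> rconv v m -> rconv (fun k => u k * v k) (l * m).
Proof. by move=> /rconvP hu /rconvP hv; apply/rconvP; exact: cvgM. Qed.

Lemma rconv_cst (l : R) : rconv (fun=> l) l.
Proof. by apply/rconvP; exact: cvg_cst. Qed.

Lemma rconv_squeeze (u b : nat -> R) l :
  (forall k, `|u k - l| <= b k) -> rconv b 0 -> rconv u l.
Proof.
move=> ub b0 e /b0[N hN]; exists N => k /hN; rewrite subr0.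
exact/le_lt_trans/(le_trans (ub k))/ler_norm.
Qed.

Lemma vconvP (x : nat -> vec) l : vconv x l <-> rconv (fun k => enorm (x k - l)) 0.
Proof.
split=> H e /H[N hN]; exists N => k /hN; first by rewrite subr0 ger0_norm ?enorm_ge0.
by rewrite subr0 ger0_norm ?enorm_ge0.
Qed.

Lemma vconv_sub (x : nat -> vec) l (s : nat -> nat) :
  (forall k, (k <= s k)%N) -> vconv x l -> vconv (x \o s) l.
Proof.
move=> hs xl e /xl[N hN]; exists N => k Nk; apply: hN.
exact: leq_trans (hs k).
Qed.

Lemma vconv_cst (l : vec) : vconv (fun=> l) l.
Proof. by move=> e e0; exists 0%N => k _; rewrite subrr enorm0. Qed.

Lemma vconvB (x y : nat -> vec) l m :
  vconv x l -> vconv y m -> vconv (fun k => x k - y k) (l - m).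
Proof.
move=> /vconvP xl /vconvP ym; apply/vconvP.
apply: (rconv_squeeze (b := fun k => enorm (x k - l) + enorm (y k - m))); last first.
  by rewrite -[0]addr0; apply: rconvD.
move=> k; rewrite subr0 ger0_norm ?enorm_ge0 // opprD addrACA -opprD.
exact: enormB.
Qed.

Lemma vconv_mulmx (x : nat -> vec) l (A : 'M[R]_n) :
  vconv x l -> vconv (fun k => x k *m A) (l *m A).
Proof.
move=> /vconvP xl; apply/vconvP.
apply: (rconv_squeeze (b := fun k => mx_l1 A * enorm (x k - l))); last first.
  by rewrite -[0](mulr0 (mx_l1 A)); apply: rconvM => //; exact: rconv_cst.
move=> k; rewrite subr0 ger0_norm ?enorm_ge0 // -mulmxBl.
exact: enorm_mulmx.
Qed.

Lemma rconv_dot (x y : nat -> vec) l m :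
  vconv x l -> vconv y m -> rconv (fun k => dot (x k) (y k)) (dot l m).
Proof.
move=> /vconvP xl /vconvP ym.
apply: (rconv_squeeze (b := fun k => enorm (x k - l) * enorm (y k - m) +
   (enorm (x k - l) * enorm m + enorm l * enorm (y k - m)))).
  move=> k /=; have -> : dot (x k) (y k) - dot l m =
    dot (x k - l) (y k - m) + (dot (x k - l) m + dot l (y k - m)).
    by rewrite !dot_linE; ring.
  apply: le_trans (ler_normD _ _) _; apply: lerD; first exact: norm_dot_le.
  by apply: le_trans (ler_normD _ _) _; apply: lerD; exact: norm_dot_le.
rewrite -[0]addr0; apply: rconvD; first by rewrite -[0](mul0r 0); exact: rconvM.
rewrite -[0]addr0; apply: rconvD.
  by rewrite -[0](mul0r (enorm m)); apply: rconvM => //; exact: rconv_cst.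
by rewrite -[0](mulr0 (enorm l)); apply: rconvM => //; exact: rconv_cst.
Qed.

Lemma rconv_enorm2 (x : nat -> vec) l :
  vconv x l -> rconv (fun k => enorm (x k) ^+ 2) (enorm l ^+ 2).
Proof.
move=> xl; rewrite enorm_sqr => e e0.
have [N hN] := rconv_dot xl xl e0; exists N => k /hN.
by rewrite enorm_sqr.
Qed.

End Sequences.

Section Taylor.
Variables (R : realType) (n : nat).
Local Notation vec := 'rV[R]_n.

Definition Taylor2 (F : vec -> R) (x a : vec) (A : 'M[R]_n) : Prop :=
  forall e : R, 0 < e -> exists d : R, 0 < d /\
    forall h : vec, enorm h < d ->
      `|F (x + h) - F x - dot a h - dot (h *m A) h / 2| <= e * enorm h ^+ 2.

Lemma Taylor2N (F : vec -> R) x a A :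
  Taylor2 F x a A -> Taylor2 (fun y => - F y) x (- a) (- A).
Proof.
move=> H e /H[d [d0 hd]]; exists d; split=> // h /hd.
rewrite mulmxN !dotNl -normrN; congr (`| _ | <= _); ring.
Qed.

(** Gradient of the second-order Taylor remainder. The quadratic part contributes the symmetrized
    matrix, since [A] is not yet known to be symmetric. *)
Lemma hasgradient_sub_quadratic (F : vec -> R) (x y v a : vec) (A : 'M[R]_n) :
  HasGradient F y v ->
  HasGradient (fun z => F z - dot a (z - x) - dot ((z - x) *m A) (z - x) / 2)
    y (v - a - (y - x) *m (2^-1 *: (A + A^T))).
Proof.
move=> H e e0; have [d [d0 hd]] := H (e / 2) (divr_gt0 e0 (ltr0Sn _ _)).
have lA := mx_l1_ge0 A; have lp : 0 < mx_l1 A + 1 by lra.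
exists (Num.min d (e / (mx_l1 A + 1))); rewrite lt_min d0 divr_gt0 //; split=> // h.
rewrite lt_min => /andP[/hd H1]; rewrite ltr_pdivlMr // => H2.
have -> : y + h - x = (y - x) + h by rewrite addrAC.
move: (y - x) => z.
have -> : dot (v - a - z *m (2^-1 *: (A + A^T))) h =
    dot v h - dot a h - (dot (z *m A) h + dot (h *m A) z) / 2.
  rewrite !dot_linE -scalemxAr dotZl mulmxDr dotDl [dot (z *m A^T) h]dotC.
  by rewrite (dot_mulmx h z A); lra.
have -> : F (y + h) - dot a (z + h) - dot ((z + h) *m A) (z + h) / 2 -
   (F y - dot a z - dot (z *m A) z / 2) -
   (dot v h - dot a h - (dot (z *m A) h + dot (h *m A) z) / 2) =
   (F (y + h) - F y - dot v h) - dot (h *m A) h / 2.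
  by rewrite mulmxDl !dot_linE; lra.
have H3 : `|dot (h *m A) h| <= e * enorm h.
  apply: le_trans (norm_dot_le _ _) _.
  have := enorm_mulmx h A; have := enorm_ge0 h; nra.
apply: le_trans (ler_normB _ _) _.
by rewrite normrM (ger0_norm (_ : 0 <= 2^-1)) ?invr_ge0 //; lra.
Qed.

(** Up to o(h), the gradient of the Taylor remainder at x + h is the antisymmetric part h (A - A^T)
    / 2, here paired with [k]. *)
Lemma remainder_small (G : vec -> vec) (x : vec) A e :
  HasDerivV G x A -> 0 < e -> exists2 d : R, 0 < d & forall h k, enorm h < d ->
  `|dot (G (x + h) - G x - (x + h - x) *m (2^-1 *: (A + A^T))) k
    - (dot (h *m A) k - dot (k *m A) h) / 2| <= e * enorm h * enorm k.
Proof.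
move=> HD e0; have [d [d0 hd]] := HD e e0; exists d => // h k /hd H.
have -> : dot (G (x + h) - G x - (x + h - x) *m (2^-1 *: (A + A^T))) k
    - (dot (h *m A) k - dot (k *m A) h) / 2 = dot (G (x + h) - G x - h *m A) k.
  rewrite (addrC x) addrK !dot_linE -scalemxAr dotZl mulmxDr dotDl.
  by rewrite [dot (h *m A^T) k]dotC (dot_mulmx k h A); lra.
apply: le_trans (norm_dot_le _ _) _.
by rewrite ler_wpM2r ?enorm_ge0.
Qed.

Lemma enormZ_le (h : vec) c : 0 <= c <= 1 -> enorm (c *: h) <= enorm h.
Proof.
by move=> /andP[c0 c1]; rewrite enormZ ger0_norm // ler_piMl ?enorm_ge0.
Qed.

(** Mean value theorem for the Taylor remainder: at the intermediate point x + c h the antisymmetric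
    term is paired with [h] itself and vanishes, which leaves o(|h|^2). *)
Lemma taylor2 (F : vec -> R) (G : vec -> vec) (x : vec) A :
  (exists2 r : R, 0 < r & forall y, enorm (y - x) < r -> HasGradient F y (G y)) ->
  HasDerivV G x A -> Taylor2 F x (G x) A.
Proof.
move=> [r r0 HG] HD e e0; have [d d0 hd] := remainder_small HD e0.
exists (Num.min d r); rewrite lt_min d0 r0; split=> // h.
rewrite lt_min => /andP[hdl hrl].
have [|c c01] := mvt_along_segment (x := x) (h := h)
  (F := fun z => F z - dot (G x) (z - x) - dot ((z - x) *m A) (z - x) / 2)
  (G := fun y => G y - G x - (y - x) *m (2^-1 *: (A + A^T))).
  move=> t t01; apply/hasgradient_sub_quadratic/HG.
  by rewrite (addrC x) addrK; apply: le_lt_trans hrl; exact: enormZ_le.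
rewrite subrr !dot0r mul0r (addrC x h) addrK => E.
have := hd (c *: h) h (le_lt_trans (enormZ_le h c01) hdl).
rewrite -E -scalemxAl dotZl dotZr subrr mul0r.
have -> : F (h + x) - dot (G x) h - dot (h *m A) h / 2 - (F x - 0 - 0) - 0 =
  F (x + h) - F x - dot (G x) h - dot (h *m A) h / 2 by rewrite (addrC x); ring.
rewrite (addrC x) => H; apply: le_trans H _.
rewrite expr2 mulrA ler_wpM2r ?enorm_ge0 // ler_wpM2l ?(ltW e0) //.
exact: enormZ_le.
Qed.

(* Mean value theorem for the second-order Taylor remainder, which is o(t^2), between
   x + t h and x + t (h + k): its gradient at x + z is z (A - A^T) / 2 + o(z). *)
Lemma hessian_symmetric (F : vec -> R) (G : vec -> vec) (x : vec) A :
  (exists2 r : R, 0 < r & forall y, enorm (y - x) < r -> HasGradient F y (G y)) ->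
  HasDerivV G x A -> forall h k, dot (h *m A) k = dot (k *m A) h.
Proof.
move=> HG HD h k; apply/eqP; rewrite -subr_eq0 -normr_le0.
apply/ler_addgt0Pr => e e0; rewrite add0r.
pose C := (enorm h + enorm k + 1) ^+ 2.
have hge := enorm_ge0 h; have kge := enorm_ge0 k.
have C0 : 0 < C by rewrite exprn_gt0 //; lra.
(* Three errors, each at most [e' * (t ^+ 2 * C)], add up to t^2 e / 2; they bound t^2 / 2 times the
   asymmetry of [A]. *)
pose e' := e / (6 * C).
have e'0 : 0 < e' by rewrite divr_gt0 // mulr_gt0.
have [d1 [d10 hd1]] := taylor2 HG HD e'0.
have [d2 d20 hd2] := remainder_small HD e'0.
have [r r0 HGr] := HG.
pose m := Num.min r (Num.min d1 d2).
have m0 : 0 < m by rewrite !lt_min r0 d10 d20.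
have N0 : 0 < enorm h + enorm k + 1 by lra.
(* Scaling by [t] brings the whole segment from t h to t (h + k) within the radius [m], where all
   estimates hold. *)
pose t := m / (enorm h + enorm k + 1).
have t0 : 0 < t by rewrite divr_gt0.
have tm (z : vec) : enorm z <= enorm h + enorm k -> enorm (t *: z) < m.
  by move=> zl; rewrite enormZ (gtr0_norm t0) mulrAC ltr_pdivrMr // ltr_pM2l //; lra.
have hk c : 0 <= c <= 1 -> enorm (h + c *: k) <= enorm h + enorm k.
  by move=> c01; apply: le_trans (enormD _ _) _; rewrite lerD2l enormZ_le.
have seg s : x + t *: h + s *: (t *: k) = x + t *: (h + s *: k).
  by rewrite scalerDr !scalerA [s * t]mulrC addrA.
have [|c c01] := mvt_along_segment (x := x + t *: h) (h := t *: k)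
  (F := fun z => F z - dot (G x) (z - x) - dot ((z - x) *m A) (z - x) / 2)
  (G := fun y => G y - G x - (y - x) *m (2^-1 *: (A + A^T))).
  move=> s s01; apply/hasgradient_sub_quadratic/HGr.
  rewrite seg (addrC x) addrK.
  by have := tm _ (hk _ s01); rewrite lt_min => /andP[].
rewrite seg -(scale1r (t *: k)) seg !scale1r !(addrC x) !addrK !(addrC _ x).
have lt1 (z : vec) : enorm (t *: z) < m -> enorm (t *: z) < d1 /\ enorm (t *: z) < d2.
  by rewrite !lt_min => /and3P[].
have hh : enorm h <= enorm h + enorm k by lra.
have [T1 _] := lt1 _ (tm _ (hk 1 (introT andP (conj ler01 (lexx 1))))).
have [T2 _] := lt1 _ (tm _ hh).
have [_ T3] := lt1 _ (tm _ (hk c c01)).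
move: (hd1 _ T1) (hd1 _ T2) (hd2 _ (t *: k) T3) (hk c c01) => {hd1 hd2}.
rewrite scale1r [x + _ - x]addrC addKr.
have -> : dot (t *: (h + c *: k) *m A) (t *: k)
    - dot (t *: k *m A) (t *: (h + c *: k))
    = t ^+ 2 * (dot (h *m A) k - dot (k *m A) h).
  by rewrite -!scalemxAl mulmxDl -scalemxAl !dot_linE; ring.
move: (dot (h *m A) k - _) => D.
set a1 := F _ - dot _ _ - _; set a2 := F _ - dot _ _ - _; set b := dot _ (t *: k).
rewrite !enormZ (gtr0_norm t0) => H1 H2 H3 hc E.
have NN : enorm (h + k) <= enorm h + enorm k by exact: enormD.
have S1 : e' * (t * enorm (h + k)) ^+ 2 <= e' * (t ^+ 2 * C).
  rewrite exprMn ler_pM2l // ler_pM2l ?exprn_gt0 // ler_sqr ?nnegrE ?enorm_ge0 //; lra.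
have S2 : e' * (t * enorm h) ^+ 2 <= e' * (t ^+ 2 * C).
  rewrite exprMn ler_pM2l // ler_pM2l ?exprn_gt0 // ler_sqr ?nnegrE ?enorm_ge0 //; lra.
have S3 : e' * (t * enorm (h + c *: k)) * (t * enorm k) <= e' * (t ^+ 2 * C).
  rewrite -[_ * _ * _]mulrA ler_pM2l // mulrACA -expr2 ler_pM2l ?exprn_gt0 //.
  rewrite /C [leRHS]expr2.
  by apply: ler_pM; rewrite ?enorm_ge0 //; lra.
have : `|t ^+ 2 * D / 2| <= 3 * (e' * (t ^+ 2 * C)).
  have -> : t ^+ 2 * D / 2 = (a1 - F x) - (a2 - F x) - (b - t ^+ 2 * D / 2).
    by rewrite -E; ring.
  apply: le_trans (ler_normB _ _) _.
  have := le_trans H3 S3.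
  have : `|a1 - F x - (a2 - F x)| <= e' * (t ^+ 2 * C) + e' * (t ^+ 2 * C).
    apply: le_trans (ler_normB _ _) _; apply: lerD.
      by apply: le_trans S1; apply: le_trans H1; rewrite le_eqVlt; apply/orP; left; apply/eqP; congr `|_|; rewrite /a1; ring.
    by apply: le_trans S2; apply: le_trans H2; rewrite le_eqVlt; apply/orP; left; apply/eqP; congr `|_|; rewrite /a2; ring.
  by lra.
have t20 : 0 < t ^+ 2 by exact: exprn_gt0.
rewrite -mulrA normrM (gtr0_norm t20) normrM (gtr0_norm (_ : 0 < 2^-1)) ?invr_gt0 //.
have -> : 3 * (e' * (t ^+ 2 * C)) = t ^+ 2 * (e / 2).
  by rewrite /e'; field; rewrite gt_eqF.
by rewrite ler_pM2l // ler_pM2r // invr_gt0.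
Qed.

(** A multiple of [h] small enough for the differentiability estimate with error 1 turns the
    Lipschitz bound into the constant L + 1; homogeneity does the rest. *)
Lemma derivative_bound (G : vec -> vec) x A L :
  (forall y, enorm (G y - G x) <= L * enorm (y - x)) -> HasDerivV G x A ->
  forall h, enorm (h *m A) <= (L + 1) * enorm h.
Proof.
move=> GL /(_ 1 ltr01)[d [d0 hd]] h.
have [/enorm_eq0 ->|h0] := eqVneq (enorm h) 0; first by rewrite mul0mx enorm0 mulr0.
have hp : 0 < enorm h by rewrite lt_def h0 enorm_ge0.
pose t := d / 2 / enorm h; have t0 : 0 < t by rewrite !divr_gt0.
have th : enorm (t *: h) = t * enorm h by rewrite enormZ gtr0_norm.
have td : t * enorm h < d by rewrite divfK //; lra.
have := hd (t *: h); rewrite th => /(_ td) H.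
have := GL (x + t *: h); rewrite (addrC x) addrK th => H2.
have : enorm (t *: (h *m A)) <= L * (t * enorm h) + 1 * (t * enorm h).
  rewrite -[t *: (h *m A)](subKr (G (t *: h + x) - G x)).
  apply: le_trans (enormB _ _) _; apply: lerD => //.
  by rewrite scalemxAl (addrC _ x).
by rewrite enormZ (gtr0_norm t0) -mulrDl mulrCA ler_pM2l.
Qed.

End Taylor.

(** * Second subderivatives and minimization *)

Section Subderivatives.
Variables (R : realType) (n : nat).
Local Notation vec := 'rV[R]_n.
Implicit Types (g psi : vec -> \bar R) (x v w s a : vec).

Lemma ereal_dense (a b : \bar R) : (a < b)%E -> exists t : R, (a < t%:E < b)%E.
Proof.
move: a b => [a||] [b||] //=; rewrite ?lte_fin => ab.
- by exists ((a + b) / 2); rewrite !lte_fin; apply/andP; split; lra.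
- by exists (a + 1); rewrite lte_fin ltey ltrDl ltr01.
- by exists (b - 1); rewrite lte_fin ltNye gtrBl ltr01.
- by exists 0; rewrite ltey ltNye.
Qed.

Lemma lee_of_lt_EFin (a b : \bar R) :
  (forall t : R, (t%:E < a)%E -> (t%:E <= b)%E) -> (a <= b)%E.
Proof.
move=> H; rewrite leNgt; apply/negP => /ereal_dense[t /andP[bt /H]].
by rewrite leNgt bt.
Qed.

(** Clears the positive factor 2 / tau^2, so that bounds on difference quotients become bounds on
    values of [psi], infinite ones included. *)
Lemma dq2_le psi x v (tau t : R) w : 0 < tau ->
  (dq2 psi x v tau w <= t%:E)%E =
  (psi (x + tau *: w)%R <=
     (fine (psi x) + tau * dot v w + t * (tau ^+ 2 / 2))%:E)%E.
Proof.
move=> t0; have q0 : 0 < 2 / tau ^+ 2 by rewrite divr_gt0 // exprn_gt0.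
rewrite /dq2; case: (psi (x + _)) => [r||] /=.
- rewrite !lee_fin -ler_pdivlMr // -[in RHS]lerBlDl; congr (_ <= _).
  by field; rewrite gt_eqF.
- by rewrite addye // gt0_mulye ?lte_fin.
- by rewrite addNye gt0_mulNye ?lte_fin // !leNye.
Qed.

Lemma dq2_ge psi x v (tau t : R) w : 0 < tau ->
  (t%:E <= dq2 psi x v tau w)%E =
  ((fine (psi x) + tau * dot v w + t * (tau ^+ 2 / 2))%:E <= psi (x + tau *: w)%R)%E.
Proof.
move=> t0; have q0 : 0 < 2 / tau ^+ 2 by rewrite divr_gt0 // exprn_gt0.
rewrite /dq2; case: (psi (x + _)) => [r||] /=.
- rewrite !lee_fin -ler_pdivrMr // -[in RHS]lerBrDl; congr (_ <= _).
  by field; rewrite gt_eqF.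
- by rewrite addye // gt0_mulye ?lte_fin // !leey.
- by rewrite addNye gt0_mulNye ?lte_fin.
Qed.

Lemma dq2_gt psi x v (tau t : R) w : 0 < tau ->
  (t%:E < dq2 psi x v tau w)%E =
  ((fine (psi x) + tau * dot v w + t * (tau ^+ 2 / 2))%:E < psi (x + tau *: w)%R)%E.
Proof. by move=> t0; rewrite ltNge dq2_le // -ltNge. Qed.

Lemma d2_gt psi x v s (t : R) : (t%:E < d2 psi x v s)%E ->
  exists2 d : R, 0 < d & forall tau w, 0 < tau < d -> enorm (w - s) < d ->
    (t%:E < dq2 psi x v tau w)%E.
Proof.
move=> /ereal_sup_gt[_ [d d0 <-] td]; exists d => // tau w taud wd.
by apply: lt_le_trans td _; apply: ereal_inf_lbound; exists tau, w.
Qed.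

Lemma d2_ge psi x v s (d : R) (t : \bar R) : 0 < d ->
  (forall tau w, 0 < tau < d -> enorm (w - s) < d -> (t <= dq2 psi x v tau w)%E) ->
  (t <= d2 psi x v s)%E.
Proof.
move=> d0 H; apply: (le_trans _ (ereal_sup_ubound _)); last by exists d.
by apply: le_ereal_inf_tmp => _ [tau [w [h1 [h2 ->]]]]; exact: H.
Qed.

Lemma d2_lt psi x v s (t : R) : (d2 psi x v s < t%:E)%E ->
  forall d : R, 0 < d -> exists tau w, [/\ 0 < tau < d, enorm (w - s) < d &
    (dq2 psi x v tau w < t%:E)%E].
Proof.
move=> H d d0; apply: contrapT => no.
move: H; rewrite ltNge => /negP; apply; apply: (d2_ge d0) => tau w taud wd.
by rewrite leNgt; apply/negP => lt; apply: no; exists tau, w.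
Qed.

Lemma quadratic_form_continuous (A : 'M[R]_n) s (e : R) : 0 < e ->
  exists2 d : R, 0 < d & forall w, enorm (w - s) < d ->
    `|dot (w *m A) w - dot (s *m A) s| <= e.
Proof.
move=> e0; have lA := mx_l1_ge0 A; have s0 := enorm_ge0 s.
pose C := (mx_l1 A + 1) * (2 * enorm s + 1).
have C0 : 0 < C by rewrite mulr_gt0 //; lra.
exists (Num.min 1 (e / C)); rewrite ?lt_min ?ltr01 ?divr_gt0 // => w.
rewrite lt_min => /andP[w1]; rewrite ltr_pdivlMr // => we.
have -> : dot (w *m A) w - dot (s *m A) s =
    dot ((w - s) *m A) w + dot (s *m A) (w - s).
  by rewrite mulmxBl !dot_linE; ring.
have ws : enorm w <= enorm s + 1.
  by rewrite -(subrK s w); apply: le_trans (enormD _ _) _; lra.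
have d0 := enorm_ge0 (w - s).
apply: le_trans (ler_normD _ _) _.
have H1 : `|dot ((w - s) *m A) w| <= mx_l1 A * enorm (w - s) * (enorm s + 1).
  apply: le_trans (norm_dot_le _ _) _.
  by apply: ler_pM => //; rewrite ?enorm_ge0 // enorm_mulmx.
have H2 : `|dot (s *m A) (w - s)| <= mx_l1 A * enorm s * enorm (w - s).
  by apply: le_trans (norm_dot_le _ _) _; rewrite ler_wpM2r // enorm_mulmx.
by have := mulr_ge0 d0 s0; move: H1 H2 we; rewrite /C; lra.
Qed.

(** The quotient of F + g is that of [g] plus <w A, w> up to an error that is small uniformly for
    [w] near [s], so lower bounds for [g] carry over to the sum. *)
Lemma d2_add_le (F : vec -> R) g x a v s (A : 'M[R]_n) :
  Taylor2 F x a A -> g x \is a fin_num ->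
  (d2 g x v s + (dot (s *m A) s)%:E <= d2 (fun y => (F y)%:E + g y)%E x (a + v)%R s)%E.
Proof.
move=> FT gx; apply: lee_of_lt_EFin => t; rewrite -lteBlDr // -EFinB.
move=> /ereal_dense[t' /andP[]]; rewrite lte_fin => tt' /d2_gt[d d0 hd].
(* The gap [e] pays for two errors of tau^2 e / 4 each: the Taylor remainder, and the variation of
   the quadratic form between [w] and [s]. *)
pose e := t' - (t - dot (s *m A) s); have e0 : 0 < e by rewrite subr_gt0.
have s0 := enorm_ge0 s.
have N0 : 0 < (enorm s + 1) ^+ 2 by rewrite exprn_gt0 //; lra.
have [d1 d10 hd1] := @quadratic_form_continuous A s (e / 2) (divr_gt0 e0 (ltr0Sn _ _)).
pose e1 := e / (4 * (enorm s + 1) ^+ 2).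
have e10 : 0 < e1 by rewrite divr_gt0 // mulr_gt0.
have [d2 [d20 hd2]] := FT e1 e10.
pose m := Num.min (Num.min d d1) (Num.min 1 (d2 / (enorm s + 1))).
have m0 : 0 < m by rewrite !lt_min d0 d10 ltr01 divr_gt0 //; lra.
apply: (d2_ge m0) => tau w /andP[tau0].
rewrite !lt_min => /andP[/andP[taud _] /andP[_]].
rewrite ltr_pdivlMr; last by lra.
move=> taud2 /andP[/andP[wd wd1] /andP[w1 _]].
have ws : enorm w <= enorm s + 1.
  by rewrite -(subrK s w); apply: le_trans (enormD _ _) _; lra.
have tw : enorm (tau *: w) < d2.
  rewrite enormZ gtr0_norm //; apply: le_lt_trans taud2.
  by rewrite ler_pM2l.
have h1 := hd1 _ wd1; have h2 := hd2 _ tw.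
have /hd/(_ wd) : 0 < tau < d by rewrite tau0.
rewrite dq2_gt // => h3; apply: ltW; rewrite dq2_gt //.
have gE : g x = (fine (g x))%:E by rewrite fineK.
move: h3; rewrite gE -EFinD /=; move: (fine (g x)) => g0 h3.
suff K : F x + g0 + tau * dot (a + v) w + t * (tau ^+ 2 / 2) <=
  F (x + tau *: w) + (g0 + tau * dot v w + t' * (tau ^+ 2 / 2)).
  apply: (@le_lt_trans _ _ (F (x + tau *: w) + (g0 + tau * dot v w + t' * (tau ^+ 2 / 2)))%:E).
    by rewrite lee_fin.
  by rewrite EFinD lteD2lE.
move: h2; rewrite -scalemxAl !dot_linE enormZ (gtr0_norm tau0) => h2.
have h4 : e1 * (tau * enorm w) ^+ 2 <= tau ^+ 2 * (e / 4).
  have -> : tau ^+ 2 * (e / 4) = e1 * (tau * (enorm s + 1)) ^+ 2.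
    by rewrite /e1; field; rewrite gt_eqF //; lra.
  rewrite ler_pM2l // ler_sqr ?nnegrE ?mulr_ge0 ?enorm_ge0 ?(ltW tau0) //; last lra.
  by rewrite ler_pM2l.
have tau20 : 0 < tau ^+ 2 by rewrite exprn_gt0.
have h5 : `|tau ^+ 2 * (dot (w *m A) w - dot (s *m A) s)| <= tau ^+ 2 * (e / 2).
  by rewrite normrM (gtr0_norm tau20) ler_pM2l.
have : tau ^+ 2 * e = tau ^+ 2 * t' - tau ^+ 2 * t + tau ^+ 2 * dot (s *m A) s.
  by rewrite /e; ring.
have := le_trans h2 h4.
rewrite !ler_norml => /andP[h6 _] h7; move: h5; rewrite ler_norml => /andP[h8 _].
by lra.
Qed.

(* The converse of [d2_add_le] is [d2_add_le] for the summands [- F] and [F + g]. *)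
Lemma d2_add (F : vec -> R) g x a v s (A : 'M[R]_n) :
  Taylor2 F x a A -> g x \is a fin_num ->
  d2 (fun y => (F y)%:E + g y)%E x (a + v)%R s = (d2 g x v s + (dot (s *m A) s)%:E)%E.
Proof.
move=> FT gx; apply/eqP; rewrite eq_le; apply/andP; split; last exact: d2_add_le.
have := @d2_add_le _ (fun y => (F y)%:E + g y)%E x _ (a + v) s _ (Taylor2N FT).
rewrite fin_numD gx => /(_ isT); rewrite addKr mulmxN dotNl EFinN leeBlDr //.
rewrite (_ : (fun y => ((- F y)%:E + _)%E) = g) //.
by apply/funext => y; rewrite addeA -EFinD addNr add0e.
Qed.

Lemma d2_finite (F : vec -> R) x a s (A : 'M[R]_n) :
  Taylor2 F x a A -> d2 (fun y => (F y)%:E) x a s = (dot (s *m A) s)%:E.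
Proof.
move=> FT; have := @d2_add F (fun=> 0%E) x a 0 s A FT isT.
rewrite addr0 (_ : (fun y => _) = (fun y => (F y)%:E)) => [->|]; last first.
  by apply/funext => y; rewrite adde0.
suff -> : d2 (fun=> 0%E : \bar R) x 0 s = 0%E by rewrite add0e.
have q0 tau w : dq2 (fun=> 0%E : \bar R) x 0 tau w = 0%E.
  by rewrite /dq2 /= dot0l mulr0 addr0 sube0 mul0e.
apply/eqP; rewrite eq_le; apply/andP; split; last first.
  by apply: (d2_ge ltr01) => tau w _ _; rewrite q0.
rewrite leNgt; apply/negP => /d2_gt[d d0] /(_ (d / 2) s).
rewrite subrr enorm0 q0 ltxx => H; suff : false by [].
by apply: H => //; apply/andP; split; lra.
Qed.

(** The epi-limit [phi] is at most the second subderivative: a value of [d2] below [phi] would give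
    points tending to [w] along which the quotients stay below [phi w], against the liminf half of
    epi-convergence. A recovery sequence for [phi] therefore serves for [d2]. *)
Lemma epi_recovery g x v : twice_epi_diff g x v ->
  forall tk : nat -> R, (forall k, 0 < tk k) -> rconv tk 0 -> forall w,
  exists wk, vconv wk w /\ limsup_le (fun k => dq2 g x v (tk k) (wk k)) (d2 g x v w).
Proof.
move=> [phi [_ H]] tk tk0 tkc w; have [_ [wk [wkc hw]]] := H tk tk0 tkc w.
exists wk; split=> // t dt; apply: hw; apply: le_lt_trans dt.
rewrite leNgt; apply/negP => /ereal_dense[u /andP[du up]].
have /choice[p hp] : forall k : nat, exists p : R * vec, [/\ 0 < p.1 < k.+1%:R^-1,
    enorm (p.2 - w) < k.+1%:R^-1 & (dq2 g x v p.1 p.2 < u%:E)%E].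
  move=> k; have [|tau [w' h]] := d2_lt du (d := k.+1%:R^-1); first by rewrite invr_gt0.
  by exists (tau, w').
have c1 : rconv (fun k => (p k).1) 0.
  apply: rconv_squeeze (@rconv_inv R) => k; have [/andP[p0 p1] _ _] := hp k.
  by rewrite subr0 gtr0_norm // ltW.
have c2 : vconv (fun k => (p k).2) w.
  apply/vconvP; apply: rconv_squeeze (@rconv_inv R) => k; have [_ p1 _] := hp k.
  by rewrite subr0 ger0_norm ?enorm_ge0 // ltW.
have p0 k : 0 < (p k).1 by have [/andP[]] := hp k.
have [+ _] := H _ p0 c1 w => /(_ _ c2 _ up)[N /(_ N (leqnn _))].
by have [_ _ h] := hp N; move/(lt_trans h); rewrite ltxx.
Qed.

End Subderivatives.

Section Minimization.
Variables (R : realType) (n : nat).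
Local Notation vec := 'rV[R]_n.

(** Direct method: a minimizing sequence kept in a bounded sublevel set has a cluster point, where
    lower semicontinuity forces the infimum to be attained. *)
Lemma lsc_argmin (psi : vec -> \bar R) x0 (M b : R) :
  lsc psi -> psi x0 \is a fin_num -> (forall u, (b%:E <= psi u)%E) ->
  (forall u, (psi u <= psi x0)%E -> enorm u <= M) ->
  exists u, forall y, (psi u <= psi y)%E.
Proof.
move=> psi_lsc fx0 psib psiM.
pose m := ereal_inf (range psi).
have lem y : (m <= psi y)%E by apply: ereal_inf_lbound; exists y.
have bm : (b%:E <= m)%E by apply: le_ereal_inf_tmp => _ [y _ <-].
have mfin : m \is a fin_num.
  rewrite fin_numElt (lt_le_trans (ltNyr b) bm) /=.
  by apply: le_lt_trans (lem x0) _; rewrite ltey_eq fx0.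
have /choice[u hu] : forall k, exists u, (psi u < m + (k.+1%:R^-1)%:E)%E /\ (psi u <= psi x0)%E.
  move=> k; have /ereal_inf_lt[_ [u _ <-] hu] : (m < m + (k.+1%:R^-1)%:E)%E.
    by rewrite lteDl // lte_fin invr_gt0.
  (* When [u] lies above the level of [x0], the point [x0] is an even better choice and belongs to
     the sublevel set. *)
  have [ux|xu] := leP (psi u) (psi x0); first by exists u.
  by exists x0; split=> //; exact: lt_trans hu.
have [l hl] := bounded_cluster (fun k => psiM _ (hu k).2).
exists l => y; apply: le_trans (lem y); rewrite leNgt; apply/negP.
move=> /ereal_dense[t /andP[mt /psi_lsc[d [d0 hd]]]].
have t0 : 0 < t - fine m by rewrite subr_gt0 -lte_fin fineK.
have [N hN] := rconv_inv t0.
have [k Nk /hd] := hl d N d0.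
apply/negP; rewrite -leNgt; apply: ltW; apply: lt_trans (hu k).1 _.
have := hN k Nk; rewrite subr0 ger0_norm ?invr_ge0 // ltrBrDl -lte_fin EFinD.
by rewrite fineK.
Qed.

Lemma lsc_add (l : vec -> R) (g : vec -> \bar R) :
  (forall x (e : R), 0 < e -> exists2 d : R, 0 < d & forall y, enorm (y - x) < d -> `|l y - l x| <= e) ->
  lsc g -> lsc (fun y => (l y)%:E + g y)%E.
Proof.
move=> lc glsc x t; rewrite -lteBlDl // -EFinB => /ereal_dense[t' /andP[]].
rewrite lte_fin => tt' /glsc[d1 [d10 h1]].
have [d2 d20 h2] := lc x (t' - (t - l x)) ltac:(by rewrite subr_gt0).
exists (Num.min d1 d2); rewrite lt_min d10; split=> // y.
rewrite lt_min => /andP[/h1 ty /h2]; rewrite ler_norml => /andP[h3 _].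
apply: (@le_lt_trans _ _ (l y + t')%:E); first by rewrite lee_fin; lra.
by rewrite EFinD lteD2lE.
Qed.

End Minimization.

(** * The second-order model *)

Section Quadratic.
Variables (R : realType) (n : nat).
Local Notation vec := 'rV[R]_n.
Implicit Types (u v w s : vec) (A B K M : 'M[R]_n).

(** In a basis [C] of the row space of [B], the equation tested on the subspace has matrix C K C^T,
    which coercivity makes invertible. *)
Lemma constrained_solver B K (c : R) : 0 < c ->
  (forall u, (u <= B)%MS -> c * dot u u <= dot (u *m K) u) ->
  exists P : 'M[R]_n, forall s, (s *m P <= B)%MS /\
    forall w, (w <= B)%MS -> dot (s *m P *m K) w = dot s w.
Proof.
move=> c0 Kpos.
have [C [CB Cinj BC]] : exists C : 'M[R]_(\rank B, n),
    [/\ forall y : 'rV_(\rank B), (y *m C <= B)%MS,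
        forall y : 'rV_(\rank B), y *m C = 0 -> y = 0 &
        forall w, (w <= B)%MS -> exists y : 'rV_(\rank B), w = y *m C].
  exists (row_base B); split=> [y|y yC|w].
  - by apply: submx_trans (submxMl _ _) _; rewrite eq_row_base.
  - by apply: (row_free_inj (row_base_free B)); rewrite yC mul0mx.
  - by rewrite -(eq_row_base B) => /submxP.
pose Z := C *m K *m C^T.
have Zu : Z \in unitmx.
  rewrite -row_free_unit; apply: inj_row_free => y yZ.
  have : c * dot (y *m C) (y *m C) <= 0.
    apply: le_trans (Kpos _ (CB y)) _.
    by move: yZ; rewrite /dot trmx_mul /Z !mulmxA => ->; rewrite mul0mx mxE.
  rewrite pmulr_rle0 // -enorm_sqr => H.
  by apply/Cinj/enorm_eq0/eqP; rewrite -sqrf_eq0 eq_le H sqr_ge0.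
exists (C^T *m invmx Z *m C) => s; split=> [|_ /BC[y ->]]; first by rewrite mulmxA.
rewrite /dot trmx_mul !mulmxA.
suff -> : s *m C^T *m invmx Z *m C *m K *m C^T = s *m C^T by [].
by rewrite -[RHS](mulmxKV Zu) /Z !mulmxA.
Qed.

(** Half the Hessian in [u] of the model [fbmodel] below; [M] is symmetrized because it is
    arbitrary. *)
Definition symK (gam : R) M : 'M[R]_n := gam^-1%:M + 2^-1 *: (M + M^T).

Lemma dot_symK gam M u v : dot (u *m symK gam M) v =
  gam^-1 * dot u v + (dot (u *m M) v + dot (v *m M) u) / 2.
Proof.
rewrite /symK mulmxDr mul_mx_scalar -scalemxAr mulmxDr !dot_linE.
by rewrite [dot (u *m M^T) v]dotC (dot_mulmx v u M); ring.
Qed.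

Lemma dot_scalarB gam A s u :
  dot (s *m (gam^-1%:M - A)) u = gam^-1 * dot s u - dot (s *m A) u.
Proof. by rewrite mulmxBr mul_mx_scalar !dot_linE. Qed.

(* The second-order model of the forward-backward objective along x = xs + tau s,
   u = xs + tau u, without the terms that do not depend on u. *)
Definition fbmodel (gam : R) A M s u : R :=
  dot (u *m M) u + 2 * dot (s *m A) u + enorm (u - s) ^+ 2 / gam.

Section Minimizer.
Variables (gam : R) (A B M : 'M[R]_n) (s u0 : vec).
Hypothesis u0B : (u0 <= B)%MS.
Hypothesis u0_stationary : forall w, (w <= B)%MS ->
  dot (u0 *m symK gam M) w = dot (s *m (gam^-1%:M - A)) w.

(** The model is quadratic in [u], so its expansion at [u0] is exact, and stationarity removes the
    linear term along the subspace. *)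
Lemma fbmodelB u : (u <= B)%MS ->
  fbmodel gam A M s u - fbmodel gam A M s u0 = dot ((u - u0) *m symK gam M) (u - u0).
Proof.
move=> uB; have := u0_stationary uB; have := u0_stationary u0B.
rewrite /fbmodel !enorm_sqr !dot_symK !dot_scalarB mulmxBl !dot_linE.
rewrite (dotC u u0) (dotC s u) (dotC s u0).
by lra.
Qed.

(** Stationarity tested on [u0] itself. With [u0] linear in [s], the right-hand side becomes the
    quadratic form of the Hessian of the envelope. *)
Lemma fbmodel_min : fbmodel gam A M s u0 - dot (s *m A) s =
  dot (s *m (gam^-1%:M - A)) (s - u0).
Proof.
have := u0_stationary u0B.
rewrite /fbmodel !enorm_sqr dot_symK dotDr dotNr !dot_scalarB !dot_linE (dotC s u0).
by lra.
Qed.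

End Minimizer.

(* The shift [u = s] bounds the minimum by [q + A] on the subspace; conversely, as
   [A] is symmetric the model splits as [(q + A)(u) + |u - s|^2 / gam - A(u - s)]. *)
Lemma fbmodel_nonneg_iff gam A B M P (L : R) :
  0 < gam -> gam * L < 1 ->
  (forall u v, dot (u *m A) v = dot (v *m A) u) ->
  (forall u, dot (u *m A) u <= L * dot u u) ->
  (forall u, (u <= B)%MS -> 0 <= dot (u *m symK gam M) u) ->
  (forall s, (s *m P <= B)%MS /\ forall w, (w <= B)%MS ->
     dot (s *m P *m symK gam M) w = dot (s *m (gam^-1%:M - A)) w) ->
  (forall s, (s <= B)%MS -> 0 <= dot (s *m M) s + dot (s *m A) s) <->
  (forall s, 0 <= dot (s *m ((1%:M - P) *m (gam^-1%:M - A^T))) s).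
Proof.
move=> gam0 gamL Asym AL Kpos HP.
have HE s : dot (s *m ((1%:M - P) *m (gam^-1%:M - A^T))) s =
    fbmodel gam A M s (s *m P) - dot (s *m A) s.
  have [sB sst] := HP s; rewrite (fbmodel_min sB sst) mulmxA dot_mulmx.
  have -> : (gam^-1%:M - A^T)^T = gam^-1%:M - A.
    by rewrite linearB /= tr_scalar_mx trmxK.
  by rewrite dotC [s *m (1%:M - P)]mulmxBr mulmx1.
split=> [H s|H s sB].
  rewrite HE; have [uB _] := HP s; have := H _ uB; move: (s *m P) => u Hu.
  have := AL (u - s); rewrite mulmxBl /fbmodel enorm_sqr.
  set N := dot (u - s) (u - s); have N0 : 0 <= N by exact: dot_ge0.
  have : L * N <= N / gam.
    by rewrite mulrC ler_wpM2l // -[L]mul1r -(mulVf (lt0r_neq0 gam0)) -mulrA ger_pMr ?invr_gt0 // ltW.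
  by rewrite !dot_linE (Asym u s); lra.
have [uB sst] := HP s.
have := fbmodelB uB sst sB; have := H s; rewrite HE.
have := Kpos (s - s *m P) (addmx_sub sB _); rewrite eqmx_opp => /(_ uB).
rewrite {2}/fbmodel subrr enorm0 expr0n mul0r addr0; lra.
Qed.

End Quadratic.

(** * Regular and limiting subgradients *)

Section Subgradients.
Variables (R : realType) (n : nat).
Local Notation vec := 'rV[R]_n.
Implicit Types (psi g : vec -> \bar R) (x v a : vec).

Lemma reg_subgrad_subgrad psi x v : reg_subgrad psi x v -> subgrad psi x v.
Proof.
move=> H; split; first by case: H.
exists (fun=> x), (fun=> v); split; first exact: vconv_cst.
by split; [exact: rconv_cst | split=> //; exact: vconv_cst].
Qed.

(** The quadratic term is at most e |y - x| once |y - x| < e / (|c| + 1), whatever the sign of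
    [c]. *)
Lemma quadratic_minorant_subgrad psi x v (c : R) : psi x \is a fin_num ->
  (forall y, ((fine (psi x) + dot v (y - x) - c * enorm (y - x) ^+ 2)%:E <= psi y)%E) ->
  reg_subgrad psi x v.
Proof.
move=> fx H; split=> // e e0; have C0 : 0 < `|c| + 1 by rewrite ltr_wpDl.
exists (e / (`|c| + 1)); rewrite divr_gt0 //; split=> // y.
rewrite ltr_pdivlMr // => h; apply: le_trans (H y); rewrite lee_fin lerD2l lerN2.
have d0 := enorm_ge0 (y - x).
rewrite expr2 mulrA ler_wpM2r //; apply: le_trans (ltW h); rewrite mulrC ler_wpM2l //.
by apply: le_trans (ler_norm _) _; rewrite lerDl.
Qed.

Lemma reg_subgrad_add (F : vec -> R) g x a v :
  HasGradient F x a -> reg_subgrad g x v ->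
  reg_subgrad (fun y => (F y)%:E + g y)%E x (a + v).
Proof.
move=> HF [gx Hg]; split=> [|e e0]; first by rewrite fin_numD gx.
have e20 : 0 < e / 2 by rewrite divr_gt0.
have [d1 [d10 h1]] := HF _ e20; have [d2 [d20 h2]] := Hg _ e20.
exists (Num.min d1 d2); rewrite lt_min d10; split=> // y.
rewrite lt_min => /andP[/h1 H1 /h2 H2].
move: H1 H2; rewrite [x + _]addrC subrK => H1 H2.
have -> : fine ((F x)%:E + g x) = F x + fine (g x) by rewrite -{1}(fineK gx).
apply: le_trans (leeD2l _ H2); rewrite -EFinD lee_fin dotDl.
by move: H1; rewrite ler_norml => /andP[]; lra.
Qed.

Lemma hasgradient_subgrad (F : vec -> R) x :
  HasGradient F x 0 -> reg_subgrad (fun y => (F y)%:E) x 0.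
Proof.
move=> HF; split=> // e e0; have [d [d0 h]] := HF e e0; exists d; split=> // y /h.
rewrite [x + _]addrC subrK dot0l subr0 ler_norml => /andP[H _].
by rewrite lee_fin /= ?dot0l; lra.
Qed.

Lemma hasgradient_continuous (F : vec -> R) x a (e : R) :
  HasGradient F x a -> 0 < e ->
  exists2 d : R, 0 < d & forall y, enorm (y - x) < d -> `|F y - F x| <= e.
Proof.
move=> HF e0; have [d [d0 h]] := HF 1 ltr01.
have C0 : 0 < enorm a + 1 by rewrite ltr_wpDl ?enorm_ge0.
exists (Num.min d (e / (enorm a + 1))); first by rewrite lt_min d0 divr_gt0.
move=> y; rewrite lt_min => /andP[/h]; rewrite [x + _]addrC subrK => H1.
rewrite ltr_pdivlMr // => H2.
have -> : F y - F x = F y - F x - dot a (y - x) + dot a (y - x) by ring.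
apply: le_trans (ler_normD _ _) _; have := norm_dot_le a (y - x); lra.
Qed.

End Subgradients.

(** * The forward-backward map and its envelope *)

Section ForwardBackward.
Variables (R : realType) (n : nat).
Local Notation vec := 'rV[R]_n.
Variables (f : vec -> R) (D : vec -> vec) (g : vec -> \bar R) (xs : vec).
Variables (gam0 gam L : R).
Hypothesis gam_gt0 : 0 < gam.
Hypothesis gam_lt : gam < gam0.
Hypothesis L_ge0 : 0 <= L.
Hypothesis D_lip : forall x y, enorm (D x - D y) <= L * enorm (x - y).
Hypothesis gxs : g xs \is a fin_num.
Hypothesis g_minorant : forall u,
  ((fine (g xs) - dot (D xs) (u - xs) - enorm (u - xs) ^+ 2 / (2 * gam0))%:E <= g u)%E.

Definition fbsmooth (x u : vec) : R :=
  f x + dot (D x) (u - x) + enorm (u - x) ^+ 2 / (2 * gam).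

(** [c] is the curvature in [u] that remains when the proximal term absorbs the concave part of the
    minorant of [g]; [a] bounds the coupling between x - xs and u - xs. *)
Let c := (gam^-1 - gam0^-1) / 2.
Let a := L + gam^-1.

Local Lemma gam0_gt0 : 0 < gam0. Proof. exact: lt_trans gam_lt. Qed.

Local Lemma c_gt0 : 0 < c.
Proof.
by rewrite divr_gt0 // subr_gt0 ltf_pV2 // posrE ?gam0_gt0.
Qed.

Local Lemma a_ge0 : 0 <= a.
Proof. by rewrite addr_ge0 // invr_ge0 ltW. Qed.

(** Inserting the minorant of [g] cancels the linear term <D xs, u - xs> up to <D x - D xs, u - xs>,
    which the Lipschitz bound on [D] controls. *)
Lemma fb_growth x u :
  ((fbsmooth x xs + fine (g xs) + c * enorm (u - xs) ^+ 2
     - a * enorm (x - xs) * enorm (u - xs))%:E <= (fbsmooth x u)%:E + g u)%E.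
Proof.
apply: le_trans (leeD2l _ (g_minorant u)); rewrite -EFinD lee_fin /fbsmooth.
have -> : u - x = (u - xs) - (x - xs) by rewrite opprB addrA subrK.
have -> : xs - x = - (x - xs) by rewrite opprB.
have := dot_ler (x - xs) (u - xs).
have := norm_dot_le (D x - D xs) (u - xs).
have := D_lip x xs.
move: (u - xs) (x - xs) => p h HL H1 H2.
rewrite dotDr !enorm_sqr /c /a !invfM.
have {H1} : - (L * enorm h * enorm p) <= dot (D x - D xs) p.
  rewrite lerNl; apply: le_trans (ler_norm _) _; rewrite normrN.
  by apply: le_trans H1 _; rewrite ler_wpM2r ?enorm_ge0.
have gi : 0 <= gam^-1 by rewrite invr_ge0 ltW.
have := ler_wpM2l gi H2.
rewrite !dot_linE (dotC p h).
by move: (dot p p) (dot h h) (dot h p) (gam^-1) (gam0^-1) (enorm h) (enorm p) => *; lra.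
Qed.

(** With p = |u - xs| and h = |x - xs|, [fb_growth] leaves c p^2 <= a h p. *)
Lemma fb_argmin_near x u :
  ((fbsmooth x u)%:E + g u <= (fbsmooth x xs)%:E + g xs)%E ->
  enorm (u - xs) <= a / c * enorm (x - xs).
Proof.
move=> /(le_trans (fb_growth x u)); rewrite -{2}(fineK gxs) -EFinD lee_fin => H.
have [->|p0] := eqVneq (enorm (u - xs)) 0.
  by rewrite mulr_ge0 ?enorm_ge0 // divr_ge0 ?a_ge0 ?(ltW c_gt0).
have pp : 0 < enorm (u - xs) by rewrite lt_def p0 enorm_ge0.
rewrite mulrAC ler_pdivlMr ?c_gt0 // -(ler_pM2r pp) mulrC.
by move: H; rewrite expr2; lra.
Qed.

Lemma fbsmooth_gradient x u : HasGradient (fbsmooth x) u (D x + gam^-1 *: (u - x)).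
Proof.
move=> e e0; exists (e * (2 * gam)); split; first by rewrite !mulr_gt0.
move=> h hd; rewrite /fbsmooth (addrAC u).
have -> : f x + dot (D x) (u - x + h) + enorm (u - x + h) ^+ 2 / (2 * gam) -
  (f x + dot (D x) (u - x) + enorm (u - x) ^+ 2 / (2 * gam)) -
  dot (D x + gam^-1 *: (u - x)) h = enorm h ^+ 2 / (2 * gam).
  rewrite !enorm_sqr; move: (u - x) => z; rewrite !dot_linE (dotC h z) invfM; lra.
have h0 := enorm_ge0 h; have g2 : 0 < 2 * gam by rewrite mulr_gt0.
by rewrite ger0_norm ?divr_ge0 ?sqr_ge0 ?(ltW g2) // ler_pdivrMr // expr2 mulrAC ler_wpM2r // ltW.
Qed.

Hypothesis g_lsc : lsc g.

Lemma fb_argmin_exists x :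
  exists u, forall y, ((fbsmooth x u)%:E + g u <= (fbsmooth x y)%:E + g y)%E.
Proof.
pose psi u := ((fbsmooth x u)%:E + g u)%E.
pose h := enorm (x - xs).
(* The lower bound uses the minimum -(a h)^2 / (4 c) of c p^2 - a h p over p. *)
apply: (@lsc_argmin R n psi xs (a / c * h + enorm xs)
  (fbsmooth x xs + fine (g xs) - (a * h) ^+ 2 / (4 * c))).
- apply: lsc_add g_lsc => y e e0.
  exact: hasgradient_continuous (fbsmooth_gradient x y) e0.
- by rewrite fin_numD gxs.
- move=> u; apply: le_trans (fb_growth x u); rewrite lee_fin -/h.
  move: (enorm (u - xs)) => p; have cp := c_gt0.
  have -> : (a * h) ^+ 2 / (4 * c) = a * h * p - c * p ^+ 2 + c * (p - a * h / (2 * c)) ^+ 2.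
    by field; rewrite gt_eqF.
  have : 0 <= c * (p - a * h / (2 * c)) ^+ 2 by rewrite mulr_ge0 ?sqr_ge0 ?ltW.
  by lra.
- move=> u /fb_argmin_near H; rewrite -(subrK xs u).
  by apply: le_trans (enormD _ _) _; rewrite lerD2r.
Qed.

Variable T : vec -> vec.
Hypothesis T_min : forall x y,
  ((fbsmooth x (T x))%:E + g (T x) <= (fbsmooth x y)%:E + g y)%E.

Lemma T_near x : enorm (T x - xs) <= a / c * enorm (x - xs).
Proof. exact/fb_argmin_near/T_min. Qed.

Lemma T_fixed : T xs = xs.
Proof.
apply/eqP; rewrite -subr_eq0; apply/eqP/enorm_eq0/eqP.
rewrite eq_le enorm_ge0 andbT; apply: le_trans (T_near xs) _.
by rewrite subrr enorm0 mulr0.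
Qed.

Lemma g_T_fin x : g (T x) \is a fin_num.
Proof.
have := T_min x xs; have := g_minorant (T x).
by rewrite -(fineK gxs) -EFinD; case: (g (T x)).
Qed.

(** Real-valued form of the envelope, to which gradients and Taylor expansions apply. *)
Definition fbmin x : R := fbsmooth x (T x) + fine (g (T x)).

Lemma fbmin_le x y : ((fbmin x - fbsmooth x y)%:E <= g y)%E.
Proof.
have := T_min x y; rewrite -(fineK (g_T_fin x)) -EFinD -/(fbmin x).
by rewrite EFinB leeBlDr // addeC.
Qed.

Lemma FBE_fbmin x : FBE f D g gam x = (fbmin x)%:E.
Proof.
apply/eqP; rewrite eq_le; apply/andP; split.
  apply: ereal_inf_lbound; exists (T x) => //.
  by rewrite -/(fbsmooth x (T x)) -[g (T x)]fineK ?g_T_fin // -EFinD.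
apply: le_ereal_inf_tmp => _ [u _ <-]; rewrite -/(fbsmooth x u).
by have := fbmin_le x u; rewrite EFinB leeBlDr // addeC.
Qed.

(** Optimality condition for T x: minimality gives [g] a global quadratic minorant touching at T x,
    with curvature -1 / gam. *)
Lemma T_subgrad x : reg_subgrad g (T x) (gam^-1 *: (x - T x) - D x).
Proof.
apply: (quadratic_minorant_subgrad (c := (2 * gam)^-1) (g_T_fin x)) => y.
apply: le_trans (fbmin_le x y); rewrite lee_fin /fbmin /fbsmooth.
have -> : y - x = (y - T x) + (T x - x) by rewrite addrA subrK.
rewrite -(opprB (T x) x); move: (y - T x) (T x - x) => p z.
by rewrite !enorm_sqr !dot_linE (dotC p z) invfM; lra.
Qed.

(** * Lipschitz continuity of the forward-backward map near [xs] *)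

Section Lipschitz.
Variables (r e : R).
Hypothesis e_gt0 : 0 < e.
Hypothesis g_prox_regular : forall x' x v : vec, enorm (x' - xs) <= e ->
  subgrad g x v -> enorm (x - xs) < e -> enorm (v - (- D xs)) < e ->
  (g x <= g xs + e%:E)%E ->
  (g x' >= g x + (dot v (x' - x) - r / 2 * enorm (x' - x) ^+ 2)%:E)%E.
Hypothesis gam_r : gam * r < 1.

(** For x near [xs], the point T x and its subgradient enter the region where prox-regularity
    applies; the bound on g (T x) comes from comparing T x with [xs]. *)
Local Lemma T_localized : exists2 d : R, 0 < d & forall x, enorm (x - xs) < d ->
  [/\ enorm (T x - xs) < e, enorm (gam^-1 *: (x - T x) - D x - (- D xs)) < e &
      (g (T x) <= g xs + e%:E)%E].
Proof.
have L0 := L_ge0.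
have [k k0 Tk] : exists2 k : R, 0 <= k & forall x, enorm (T x - xs) <= k * enorm (x - xs).
  by exists (a / c); [rewrite divr_ge0 ?a_ge0 ?(ltW c_gt0) | exact: T_near].
have [gi gi0 giE] : exists2 gi : R, 0 < gi & gam^-1 = gi.
  by exists gam^-1; rewrite ?invr_gt0.
have [N N0 NE] : exists2 N : R, 0 <= N & enorm (D xs) = N.
  by exists (enorm (D xs)); rewrite ?enorm_ge0.
(* [W] dominates the constants of all three estimates: k for the point, gi (1 + k) + L for the
   subgradient, (N + L) k + gi for the value of [g]. *)
pose W := 1 + k + gi * (1 + k) + L + (N + L) * k + gi.
have W1 : 0 <= gi * (1 + k) by rewrite mulr_ge0 ?ltW //; lra.
have W2 : 0 <= (N + L) * k by rewrite mulr_ge0 // addr_ge0.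
have W0 : 0 < W by rewrite /W; lra.
exists (Num.min 1 (e / W)); first by rewrite lt_min ltr01 divr_gt0.
move=> x; rewrite lt_min ltr_pdivlMr // => /andP[x1 xe]; rewrite giE.
have h0 := enorm_ge0 (x - xs); have Tn : enorm (T x - xs) <= k * enorm (x - xs) by exact: Tk.
have DL := D_lip x xs.
have We (w : R) : w <= W -> enorm (x - xs) * w < e.
  by move=> wW; apply: le_lt_trans xe; rewrite ler_wpM2l.
split.
- by apply: le_lt_trans Tn _; rewrite mulrC We // /W; lra.
- have -> : gi *: (x - T x) - D x - (- D xs) =
      gi *: ((x - xs) - (T x - xs)) - (D x - D xs).
    by apply/rowP => i; rewrite !mxE; ring.
  apply: le_lt_trans (We (gi * (1 + k) + L) _); last by rewrite /W; lra.
  apply: le_trans (enormB _ _) _; rewrite enormZ (gtr0_norm gi0) mulrDr.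
  apply: lerD; last by rewrite mulrC.
  rewrite mulrCA ler_pM2l //; apply: le_trans (enormB _ _) _; lra.
- have := fbmin_le x xs; rewrite -(fineK gxs) -(fineK (g_T_fin x)) !lee_fin => H.
  apply: le_trans (_ : fine (g xs) + enorm (x - xs) * W <= _); last by rewrite lerD2l ltW.
  have : fbsmooth x xs - fbsmooth x (T x) <= enorm (x - xs) * W.
    rewrite /fbsmooth (enormBC xs x).
    have -> : T x - x = (T x - xs) + (xs - x) by rewrite addrA subrK.
    have t0 : 0 <= enorm (T x - xs + (xs - x)) ^+ 2 / (2 * gam).
      by rewrite divr_ge0 ?sqr_ge0 // mulr_ge0 // ltW.
    have t1 : - dot (D x) (T x - xs) <= (N + L) * k * enorm (x - xs).
      apply: le_trans (_ : enorm (D x) * enorm (T x - xs) <= _).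
        by rewrite -dotNr; apply: le_trans (dot_ler _ _) _; rewrite enormN.
      rewrite -mulrA; apply: ler_pM; rewrite ?enorm_ge0 //.
      rewrite -(subrK (D xs) (D x)); apply: le_trans (enormD _ _) _; rewrite NE.
      have : L * enorm (x - xs) <= L by rewrite ler_piMr // ltW.
      by lra.
    have t2 : enorm (x - xs) ^+ 2 / (2 * gam) <= enorm (x - xs) * gi.
      rewrite expr2 -mulrA ler_wpM2l // invfM giE mulrA ler_piMl ?(ltW gi0) //; lra.
    have t3 : 0 <= enorm (x - xs) * (1 + k + gi * (1 + k) + L).
      by rewrite mulr_ge0 //; lra.
    by rewrite (dotDr (T x - xs)) /W; lra.
  by move: H; rewrite /fbmin; lra.
Qed.

(** Adding the prox-regularity inequalities at T x and T y gives (1 / gam - r) |T x - T y|^2 <= a |x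
    - y| |T x - T y|, and gam r < 1 makes the left factor positive. *)
Lemma T_lipschitz : exists2 d : R, 0 < d & exists2 C : R, 0 <= C &
  forall x y, enorm (x - xs) < d -> enorm (y - xs) < d ->
  enorm (T x - T y) <= C * enorm (x - y).
Proof.
have L0 := L_ge0.
have gi : 0 < gam^-1 by rewrite invr_gt0.
have gr : 0 < gam^-1 - r.
  by rewrite subr_gt0 -[r]mul1r -(mulVf (lt0r_neq0 gam_gt0)) -mulrA gtr_pMr.
have [d d0 hd] := T_localized; exists d => //.
exists (a / (gam^-1 - r)); first by rewrite divr_ge0 ?a_ge0 // ltW.
have mono x y : enorm (x - xs) < d -> enorm (y - xs) < d ->
    fine (g (T x)) + (dot (gam^-1 *: (x - T x) - D x) (T y - T x)
       - r / 2 * enorm (T y - T x) ^+ 2) <= fine (g (T y)).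
  move=> /hd[x1 x2 x3] /hd[y1 y2 y3].
  have := g_prox_regular (ltW y1) (reg_subgrad_subgrad (T_subgrad x)) x1 x2 x3.
  by rewrite -{1}(fineK (g_T_fin x)) -{1}(fineK (g_T_fin y)) -EFinD lee_fin.
move=> x y xd yd; have := mono x y xd yd; have := mono y x yd xd.
have := norm_dot_le (D x - D y) (T x - T y).
have := D_lip x y; have := dot_ler (x - y) (T x - T y).
have -> : dot (gam^-1 *: (y - T y) - D y) (T x - T y) =
   dot (gam^-1 *: (x - T x) - D x) (T x - T y) - gam^-1 * dot (x - y) (T x - T y)
   + gam^-1 * dot (T x - T y) (T x - T y) + dot (D x - D y) (T x - T y).
  by rewrite !dot_linE; ring.
rewrite -(opprB (T x) (T y)) dotNr enormN -enorm_sqr.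
have p0 := enorm_ge0 (T x - T y); have z0 := enorm_ge0 (x - y).
move=> H1 H2 H3 H4 H5.
have {H3} : - (L * enorm (x - y) * enorm (T x - T y)) <= dot (D x - D y) (T x - T y).
  rewrite lerNl; apply: le_trans (ler_norm _) _; rewrite normrN.
  by apply: le_trans H3 _; rewrite ler_wpM2r.
have := ler_wpM2l (ltW gi) H1 => H6 H7.
have [->|pn] := eqVneq (enorm (T x - T y)) 0.
  by rewrite mulr_ge0 // divr_ge0 ?a_ge0 // ltW.
have pp : 0 < enorm (T x - T y) by rewrite lt_def pn.
rewrite mulrAC ler_pdivlMr // -(ler_pM2r pp) /a.
by lra.
Qed.

End Lipschitz.

(** * Gradient of the envelope *)

Lemma fbsmooth_shift x (Hx : 'M[R]_n) (e : R) :
  HasGradient f x (D x) -> HasDerivV D x Hx -> 0 < e ->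
  exists2 d : R, 0 < d & forall h u, enorm h < d ->
  `|fbsmooth (x + h) u - fbsmooth x u - dot (h *m (gam^-1%:M - Hx)) (x - u)|
    <= e * enorm h * (1 + enorm (u - x)).
Proof.
have L0 := L_ge0.
move=> Hf HD e0; have e20 : 0 < e / 2 by rewrite divr_gt0.
have [d1 [d10 h1]] := Hf _ e20; have [d2 [d20 h2]] := HD _ e20.
have gi : 0 < gam^-1 by rewrite invr_gt0.
have ap : 0 < a by rewrite ltr_wpDl.
pose m := Num.min (Num.min d1 d2) (e / 2 / a).
have m0 : 0 < m by rewrite !lt_min d10 d20 divr_gt0.
exists m => // h u; rewrite !lt_min => /andP[/andP[/h1 H1 /h2 H2]].
rewrite ltr_pdivlMr // => ha.
(* The first-order terms <D x, h> from [f] and from the linear part cancel. What remains is bounded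
   uniformly in [u] up to 1 + |u - x|, so the estimate also applies at the moving minimizer T (x +
   h). *)
have -> : fbsmooth (x + h) u - fbsmooth x u - dot (h *m (gam^-1%:M - Hx)) (x - u) =
  (f (x + h) - f x - dot (D x) h) + dot (D (x + h) - D x - h *m Hx) (u - x)
  - dot (D (x + h) - D x) h + gam^-1 / 2 * enorm h ^+ 2.
  rewrite /fbsmooth dot_scalarB -(opprB u x) opprD addrA.
  move: (u - x) => z; rewrite !enorm_sqr !dot_linE invfM (dotC z h); lra.
have h0 := enorm_ge0 h; have z0 := enorm_ge0 (u - x).
have H3 : `|dot (D (x + h) - D x - h *m Hx) (u - x)| <= e / 2 * enorm h * enorm (u - x).
  by apply: le_trans (norm_dot_le _ _) _; rewrite ler_wpM2r.
have H4 : `|dot (D (x + h) - D x) h| <= L * enorm h * enorm h.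
  apply: le_trans (norm_dot_le _ _) _; rewrite ler_wpM2r //.
  by have := D_lip (x + h) x; rewrite [x + h]addrC addrK.
have H5 : `|gam^-1 / 2 * enorm h ^+ 2| <= gam^-1 * enorm h * enorm h.
  rewrite ger0_norm ?mulr_ge0 ?sqr_ge0 ?invr_ge0 ?(ltW gam_gt0) // expr2 mulrA.
  by rewrite !ler_wpM2r // ler_piMr ?(ltW gi) // invf_le1 // ler1n.
have H6 : (L + gam^-1) * enorm h * enorm h <= e / 2 * enorm h.
  by rewrite ler_wpM2r // mulrC ltW.
have H7 : 0 <= e * enorm h * enorm (u - x) by rewrite !mulr_ge0 // ltW.
apply: le_trans (ler_normD _ _) _.
have K1 := ler_normB (f (x + h) - f x - dot (D x) h + dot (D (x + h) - D x - h *m Hx) (u - x)) (dot (D (x + h) - D x) h).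
have K2 := ler_normD (f (x + h) - f x - dot (D x) h) (dot (D (x + h) - D x - h *m Hx) (u - x)).
by lra.
Qed.

(** Envelope argument: the increment of [fbmin] lies between the increments of [fbsmooth] in its
    first variable with [u] frozen at T (x + h) and at T x. Their first-order terms differ by
    O(|h|^2) because T (x + h) - T x = O(|h|). *)
Lemma fbmin_gradient x (Hx : 'M[R]_n) (d C : R) :
  HasGradient f x (D x) -> HasDerivV D x Hx -> 0 < d -> 0 <= C ->
  (forall h, enorm h < d -> enorm (T (x + h) - T x) <= C * enorm h) ->
  HasGradient fbmin x ((x - T x) *m (gam^-1%:M - Hx^T)).
Proof.
have L0 := L_ge0.
move=> Hf HD d0 C0 TC e e0.
pose B := gam^-1%:M - Hx.
have BT : B^T = gam^-1%:M - Hx^T by rewrite linearB /= tr_scalar_mx.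
(* [N] bounds 1 + |u - x| for every [u] within C d of T x, hence for both minimizers. *)
pose N := 1 + (C * d + enorm (T x - x)).
have N0 : 0 < N by rewrite ltr_wpDr // addr_ge0 ?enorm_ge0 // mulr_ge0 // ltW.
have e1 : 0 < e / 2 / N by rewrite !divr_gt0.
have [d1 d10 h1] := fbsmooth_shift Hf HD e1.
have Q0 : 0 < mx_l1 B * C + 1 by rewrite ltr_wpDl // mulr_ge0 // mx_l1_ge0.
exists (Num.min (Num.min d d1) (e / 2 / (mx_l1 B * C + 1))).
rewrite !lt_min d0 d10 !divr_gt0 //; split=> // h.
rewrite !lt_min => /andP[/andP[hd /h1 H1]]; rewrite ltr_pdivlMr // => hq.
have h0 := enorm_ge0 h.
have Th := TC _ hd.
have near u : enorm (u - T x) <= C * enorm h ->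
    `|fbsmooth (x + h) u - fbsmooth x u - dot (h *m B) (x - u)| <= e / 2 * enorm h.
  move=> uT; apply: le_trans (H1 u) _.
  have uN : 1 + enorm (u - x) <= N.
    rewrite lerD2l; have -> : u - x = (u - T x) + (T x - x) by rewrite addrA subrK.
    apply: le_trans (enormD _ _) _; rewrite lerD2r; apply: le_trans uT _.
    by rewrite ler_wpM2l // ltW.
  rewrite [leRHS](_ : _ = e / 2 / N * enorm h * N); last by field; rewrite gt_eqF.
  by rewrite ler_wpM2l // mulr_ge0 // ltW.
have U : fbmin (x + h) - fbmin x <= fbsmooth (x + h) (T x) - fbsmooth x (T x).
  have := fbmin_le (x + h) (T x); rewrite -(fineK (g_T_fin x)) lee_fin /fbmin; lra.
have V : fbsmooth (x + h) (T (x + h)) - fbsmooth x (T (x + h)) <= fbmin (x + h) - fbmin x.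
  have := fbmin_le x (T (x + h)); rewrite -(fineK (g_T_fin (x + h))) lee_fin /fbmin; lra.
rewrite -BT dotC -(dot_mulmx _ _ B).
have := near (T x); rewrite subrr enorm0 mulr_ge0 // => /(_ isT).
have := near _ Th; rewrite !ler_norml => /andP[V1 _] /andP[_ U1].
have W : `|dot (h *m B) (T (x + h) - T x)| <= e / 2 * enorm h.
  apply: le_trans (norm_dot_le _ _) _.
  apply: le_trans (_ : mx_l1 B * enorm h * (C * enorm h) <= _).
    by apply: ler_pM; rewrite ?enorm_ge0 // enorm_mulmx.
  by rewrite mulrCA mulrA [C * _]mulrC ler_wpM2r //; lra.
move: W; rewrite ler_norml => /andP[W1 W2].
have E : dot (h *m B) (x - T (x + h)) =
  dot (h *m B) (x - T x) - dot (h *m B) (T (x + h) - T x) by rewrite !dot_linE; ring.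
apply/andP; split; lra.
Qed.

(** * Derivatives at [xs] of the forward-backward map and of the envelope gradient *)

Section Derivative.
Variables (A B M : 'M[R]_n).
Hypothesis DA : HasDerivV D xs A.
Hypothesis g_epi : twice_epi_diff g xs (- D xs).
Hypothesis g_d2 : forall s, d2 g xs (- D xs) s =
  if (s <= B)%MS then (dot s (s *m M^T))%:E else +oo%E.

(** By the minorant, g + |. - xs|^2 / (2 gam0) lies above an affine function touching at [xs], so
    its second subderivative is nonnegative; the sum rule isolates that of [g]. *)
Lemma d2_minorant s : (s <= B)%MS -> - (gam0^-1 * dot s s) <= dot (s *m M) s.
Proof.
move=> sB; pose F (y : vec) := enorm (y - xs) ^+ 2 / (2 * gam0).
have FT : Taylor2 F xs 0 (gam0^-1)%:M.
  move=> e e0; exists 1; split=> // h _; rewrite /F subrr enorm0 [xs + h]addrC addrK.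
  rewrite mul_mx_scalar dotZl dot0l -enorm_sqr invfM.
  have -> : enorm h ^+ 2 * (2^-1 * gam0^-1) - 0 ^+ 2 * (2^-1 * gam0^-1) - 0 -
     gam0^-1 * enorm h ^+ 2 / 2 = 0 by ring.
  by rewrite normr0 mulr_ge0 ?sqr_ge0 // ltW.
have : (0 <= d2 (fun y => (F y)%:E + g y)%E xs (0 + - D xs)%R s)%E.
  apply: (d2_ge ltr01) => tau w /andP[tau0 _] _; rewrite dq2_ge //.
  have -> : fine ((F xs)%:E + g xs) = fine (g xs).
    by rewrite /F subrr enorm0 expr0n /= mul0r add0e.
  apply: le_trans (leeD2l _ (g_minorant _)); rewrite -EFinD lee_fin /F.
  by rewrite [xs + _]addrC addrK add0r !dot_linE; lra.
rewrite (d2_add _ _ FT gxs) g_d2 sB mul_mx_scalar -dot_mulmx dotZl -EFinD lee_fin.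
by lra.
Qed.

Lemma symK_coercive u : (u <= B)%MS ->
  (gam^-1 - gam0^-1) * dot u u <= dot (u *m symK gam M) u.
Proof. by move=> /d2_minorant H; rewrite dot_symK; lra. Qed.

Lemma D_quotient (tk : nat -> R) (sk : nat -> vec) s :
  (forall k, 0 < tk k) -> rconv tk 0 -> vconv sk s ->
  vconv (fun k => (tk k)^-1 *: (D (xs + tk k *: sk k) - D xs)) (s *m A).
Proof.
move=> tk0 tkc skc e e0.
have s0 := enorm_ge0 s; have lA := mx_l1_ge0 A.
have s1 : 0 < enorm s + 1 by lra.
have lA1 : 0 < mx_l1 A + 1 by lra.
have e1 : 0 < e / 2 / (enorm s + 1) by rewrite !divr_gt0.
have [d [d0 hd]] := DA e1.
have m0 : 0 < Num.min 1 (e / 2 / (mx_l1 A + 1)) by rewrite lt_min ltr01 !divr_gt0.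
have [N1 hN1] := skc _ m0.
have [N2 hN2] := tkc _ (divr_gt0 d0 s1).
exists (maxn N1 N2) => k; rewrite geq_max => /andP[/hN1 + /hN2].
rewrite lt_min subr0 gtr0_norm // => /andP[sk1 sk2] tkd.
have skn : enorm (sk k) <= enorm s + 1.
  by rewrite -(subrK s (sk k)); apply: le_trans (enormD _ _) _; lra.
have tkn : enorm (tk k *: sk k) < d.
  rewrite enormZ gtr0_norm //; apply: le_lt_trans (_ : tk k * (enorm s + 1) < _).
    by rewrite ler_pM2l.
  by rewrite -ltr_pdivlMr.
have -> : (tk k)^-1 *: (D (xs + tk k *: sk k) - D xs) - s *m A =
   (tk k)^-1 *: (D (xs + tk k *: sk k) - D xs - (tk k *: sk k) *m A) + (sk k - s) *m A.
  rewrite -scalemxAl [_ *: (_ - _ *: _)]scalerBr scalerA mulVf ?gt_eqF // scale1r mulmxBl.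
  by rewrite addrA subrK.
apply: le_lt_trans (enormD _ _) _; rewrite [e in _ < e]splitr; apply: ler_ltD.
  rewrite enormZ gtr0_norm ?invr_gt0 // mulrC ler_pdivrMr //.
  apply: le_trans (hd _ tkn) _; rewrite enormZ gtr0_norm // mulrA mulrAC ler_pM2r //.
  by rewrite mulrAC ler_pdivrMr // ler_pM2l // divr_gt0.
apply: le_lt_trans (enorm_mulmx _ _) _.
apply: le_lt_trans (_ : (mx_l1 A + 1) * enorm (sk k - s) < _).
  by rewrite ler_wpM2r ?enorm_ge0 // lerDl.
by rewrite mulrC -ltr_pdivlMr.
Qed.

Variable P : 'M[R]_n.
Hypothesis P_stationary : forall s, (s *m P <= B)%MS /\ forall w, (w <= B)%MS ->
  dot (s *m P *m symK gam M) w = dot (s *m (gam^-1%:M - A)) w.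

(** Minimality of T is tested against a recovery sequence for [w]; after division by tau^2 / 2 the
    inequality passes to the limit. *)
Lemma T_quotient_model (tk : nat -> R) (sk uk : nat -> vec) s u w :
  (forall k, 0 < tk k) -> rconv tk 0 -> vconv sk s -> vconv uk u ->
  (forall k, T (xs + tk k *: sk k) = xs + tk k *: uk k) -> (w <= B)%MS ->
  (u <= B)%MS /\ fbmodel gam A M s u <= fbmodel gam A M s w.
Proof.
move=> tk0 tkc skc ukc TE wB.
(* [b] is the smooth part of the model at [w] minus that at [u], the limit of the scaled differences
   [bk]. *)
pose b := 2 * dot (s *m A) (w - u) + (enorm (w - s) ^+ 2 - enorm (u - s) ^+ 2) / gam.
(* A finite bound on [d2] at [u] also forces [u] into the subspace. *)
suff H : (d2 g xs (- D xs) u <= (dot (w *m M) w + b)%:E)%E.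
  move: H; rewrite g_d2; case: ifP => // uB; rewrite lee_fin -dot_mulmx /fbmodel /b.
  by rewrite !dot_linE; split=> //; lra.
rewrite leNgt; apply/negP => /ereal_dense[t /andP[]]; rewrite lte_fin => bt tu.
have [wk [wkc wk_lim]] := epi_recovery g_epi tk0 tkc w.
(* Half of the gap goes to the recovery sequence and half to the convergence of [bk]; together they
   bound the quotient at [uk k] by [t], against the choice of [t] below [d2] at [u]. *)
pose e := (t - (dot (w *m M) w + b)) / 2.
have e0 : 0 < e by rewrite divr_gt0 // subr_gt0.
pose ak k := (tk k)^-1 *: (D (xs + tk k *: sk k) - D xs).
pose bk k := 2 * dot (ak k) (wk k - uk k) +
  (enorm (wk k - sk k) ^+ 2 - enorm (uk k - sk k) ^+ 2) / gam.
have bkc : rconv bk b.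
  apply: rconvD; first apply: rconvM (rconv_cst _) _.
    by apply: rconv_dot; [exact: D_quotient | exact: vconvB].
  apply: rconvM (rconv_cst _); apply: rconvD.
    by apply/rconv_enorm2/vconvB.
  rewrite -[- _]mulN1r; have := rconvM (rconv_cst (-1)) (rconv_enorm2 (vconvB ukc skc)).
  by under eq_fun do rewrite mulN1r.
have [d d0 hd] := d2_gt tu.
have [|N1 h1] := wk_lim (dot (w *m M) w + e).
  by rewrite g_d2 wB lte_fin -dot_mulmx ltrDl.
have [N2 h2] := bkc _ e0; have [N3 h3] := ukc _ d0; have [N4 h4] := tkc _ d0.
pose k := maxn (maxn N1 N2) (maxn N3 N4).
have k1 : (N1 <= k)%N by rewrite /k !leq_max leqnn.
have k2 : (N2 <= k)%N by rewrite /k !leq_max leqnn orbT.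
have k3 : (N3 <= k)%N by rewrite /k !leq_max leqnn !orbT.
have k4 : (N4 <= k)%N by rewrite /k !leq_max leqnn !orbT.
have {}h2 := h2 k k2; have {}h3 := h3 k k3; have := h4 k k4.
rewrite subr0 gtr0_norm // => tkd.
have := hd (tk k) (uk k); rewrite tk0 tkd => /(_ isT h3).
apply/negP; rewrite -leNgt dq2_le //.
have := ltW (h1 k k1); rewrite dq2_le // => gw.
have := fbmin_le (xs + tk k *: sk k) (xs + tk k *: wk k).
move=> /le_trans/(_ gw).
rewrite /fbmin TE lee_fin.
have gf : g (xs + tk k *: uk k) \is a fin_num by rewrite -TE; exact: g_T_fin.
rewrite -[g (xs + _ *: uk k)]fineK // lee_fin /=.
have DE : D (xs + tk k *: sk k) = D xs + tk k *: ak k.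
  by rewrite scalerA mulfV ?gt_eqF // scale1r [RHS]addrC subrK.
have dE v : xs + tk k *: v - (xs + tk k *: sk k) = tk k *: (v - sk k).
  by rewrite opprD addrACA subrr add0r scalerBr.
rewrite /fbsmooth DE !dE !enormZ (gtr0_norm (tk0 k)).
have tt : 0 < tk k ^+ 2 / 2 by rewrite divr_gt0 // exprn_gt0.
have {}h2 : tk k ^+ 2 / 2 * bk k <= tk k ^+ 2 / 2 * (b + e).
  rewrite ler_pM2l //; move: h2; rewrite ltr_norml => /andP[_]; lra.
have te : t = dot (w *m M) w + b + 2 * e by rewrite /e; field.
move: h2; rewrite te /bk !invfM; move: (ak k) (uk k) (wk k) (sk k) => ak' u' w' s'.
rewrite !exprMn; move: (enorm (w' - s') ^+ 2) (enorm (u' - s') ^+ 2) => nw nu.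
rewrite !dot_linE; lra.
Qed.

(** The excess of the model at [u] over its value at s P is a coercive quadratic form in u - s P;
    being nonpositive, it forces equality. *)
Lemma T_quotient_limit (tk : nat -> R) (sk uk : nat -> vec) s u :
  (forall k, 0 < tk k) -> rconv tk 0 -> vconv sk s -> vconv uk u ->
  (forall k, T (xs + tk k *: sk k) = xs + tk k *: uk k) -> u = s *m P.
Proof.
move=> tk0 tkc skc ukc TE; have [PB Pst] := P_stationary s.
have [uB H] := T_quotient_model tk0 tkc skc ukc TE PB.
have dB : (u - s *m P <= B)%MS by rewrite addmx_sub // eqmx_opp.
have := symK_coercive dB; rewrite -(fbmodelB PB Pst uB) => K.
have : (gam^-1 - gam0^-1) * dot (u - s *m P) (u - s *m P) <= 0 by lra.
have g0 : 0 < gam^-1 - gam0^-1 by have := c_gt0; rewrite /c; lra.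
rewrite pmulr_rle0 // -enorm_sqr => N; apply/eqP; rewrite -subr_eq0.
by apply/eqP/enorm_eq0/eqP; rewrite -sqrf_eq0 eq_le N sqr_ge0.
Qed.

(** By contradiction: increments [hk] tending to 0 with error above e |hk| are normalized.
    Directions and quotients are bounded, the latter by [T_near], so limits [s] and [u] exist along
    an extraction, and u = s P contradicts the error bound. *)
Lemma T_derivative : HasDerivV T xs P.
Proof.
apply: contrapT => no.
have [e e0 H] : exists2 e : R, 0 < e & forall k : nat, exists h,
    enorm h < k.+1%:R^-1 /\ e * enorm h < enorm (T (xs + h) - T xs - h *m P).
  apply: contrapT => no2; apply: no => e e0.
  apply: contrapT => no3; apply: no2; exists e => // k.
  apply: contrapT => no4; apply: no3; exists k.+1%:R^-1; split=> [|h hk].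
    by rewrite invr_gt0.
  by rewrite leNgt; apply/negP => lt; apply: no4; exists h.
have {H} [hk H] := choice H.
have hk0 k : 0 < enorm (hk k).
  rewrite lt_def enorm_ge0 andbT; apply/eqP => /enorm_eq0 h0.
  have [_] := H k; rewrite h0 addr0 subrr mul0mx subr0 enorm0 mulr0.
  by rewrite ltxx.
pose sk k := (enorm (hk k))^-1 *: hk k.
pose uk k := (enorm (hk k))^-1 *: (T (xs + hk k) - xs).
have skE k : enorm (hk k) *: sk k = hk k.
  by rewrite scalerA mulfV ?gt_eqF // scale1r.
have ukE k : T (xs + enorm (hk k) *: sk k) = xs + enorm (hk k) *: uk k.
  by rewrite skE scalerA mulfV ?gt_eqF // scale1r [RHS]addrC subrK.
have skb k : enorm (sk k) <= 1.
  by rewrite enormZ gtr0_norm ?invr_gt0 // mulVf // gt_eqF.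
have ukb k : enorm (uk k) <= a / c.
  rewrite enormZ gtr0_norm ?invr_gt0 // mulrC ler_pdivrMr //.
  by have := T_near (xs + hk k); rewrite [xs + _]addrC addrK.
have [s [i1 [i1k sc]]] := BolzanoWeierstrass skb.
have [u [i2 [i2k uc]]] := BolzanoWeierstrass (fun k => ukb (i1 k)).
pose i := i1 \o i2; have ik k : (k <= i k)%N by exact: leq_trans (i2k k) (i1k _).
have tc : rconv (fun k => enorm (hk (i k))) 0.
  apply: rconv_squeeze (@rconv_inv R) => k; rewrite subr0 gtr0_norm //.
  apply: ltW; apply: lt_le_trans (H _).1 _.
  by rewrite lef_pV2 ?posrE // ler_nat ltnS.
have ic : vconv (fun k => sk (i k)) s by exact: vconv_sub i2k sc.
have uE := T_quotient_limit (fun k => hk0 (i k)) tc ic uc (fun k => ukE (i k)).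
have := vconvB uc (vconv_mulmx P ic); rewrite uE subrr => /(_ e e0)[N /(_ N (leqnn _))].
rewrite subr0 /= -/(i N); apply/negP; rewrite -leNgt; apply: ltW.
have [_] := H (i N); rewrite T_fixed -[in X in _ < X](skE (i N)) ukE.
rewrite [xs + _]addrC addrK -scalemxAl -scalerBr enormZ (gtr0_norm (hk0 _)).
by rewrite mulrC ltr_pM2l.
Qed.

(** Product rule: the factor y - T y vanishes at [xs], so continuity of [Hf] at [xs] suffices for
    the other factor. *)
Lemma fbgradient_derivative (Hf : vec -> 'M[R]_n) :
  Hf xs = A -> mx_continuous_at Hf xs ->
  HasDerivV (fun y => (y - T y) *m (gam^-1%:M - (Hf y)^T)) xs
    ((1%:M - P) *m (gam^-1%:M - A^T)).
Proof.
move=> HA Hc e e0.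
pose k := a / c; have k0 : 0 <= k by rewrite divr_ge0 ?a_ge0 ?(ltW c_gt0).
pose Z := gam^-1%:M - A^T; have lZ := mx_l1_ge0 Z.
have lZ1 : 0 < mx_l1 Z + 1 by lra.
have k1 : 0 < 1 + k by lra.
have e1 : 0 < e / 2 / (mx_l1 Z + 1) by rewrite !divr_gt0.
have e2 : 0 < e / 2 / (1 + k) by rewrite !divr_gt0.
have [d1 [d10 h1]] := T_derivative e1.
have [d2 d20 h2] := mx_l1_continuous Hc e2.
exists (Num.min d1 d2); rewrite lt_min d10; split=> // h.
rewrite lt_min => /andP[/h1 H1 hd2]; have h0 := enorm_ge0 h.
have {h2} H2 : mx_l1 (Hf (xs + h) - Hf xs) <= e / 2 / (1 + k).
  by apply: h2; rewrite [xs + h]addrC addrK.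
have H3 : enorm (T (xs + h) - xs) <= k * enorm h.
  by have := T_near (xs + h); rewrite [xs + h]addrC addrK.
have -> : (xs + h - T (xs + h)) *m (gam^-1%:M - (Hf (xs + h))^T)
   - (xs - T xs) *m (gam^-1%:M - (Hf xs)^T) - h *m ((1%:M - P) *m (gam^-1%:M - A^T)) =
   - ((T (xs + h) - T xs - h *m P) *m Z)
   - ((h - (T (xs + h) - xs)) *m (Hf (xs + h) - Hf xs)^T).
  rewrite T_fixed subrr mul0mx subr0 HA -/Z.
  have -> : xs + h - T (xs + h) = h - (T (xs + h) - xs).
    by apply/rowP => j; rewrite !mxE; ring.
  move: (T (xs + h) - xs) => q.
  have -> : gam^-1%:M - (Hf (xs + h))^T = Z - (Hf (xs + h) - A)^T.
    by rewrite linearB /= /Z opprB addrA subrK.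
  rewrite mulmxA [h *m (1%:M - P)]mulmxBr mulmx1 [(h - q) *m (Z - _)]mulmxBr addrAC.
  by congr (_ - _); rewrite -mulmxBl -[RHS]mulNmx; congr (_ *m _); apply/rowP => j; rewrite !mxE; ring.
apply: le_trans (enormB _ _) _; rewrite enormN.
have H4 : enorm ((T (xs + h) - T xs - h *m P) *m Z) <= e / 2 * enorm h.
  apply: le_trans (enorm_mulmx _ _) _.
  apply: le_trans (ler_wpM2l lZ H1) _; rewrite mulrA ler_wpM2r // mulrA ler_pdivrMr //.
  by rewrite mulrC ler_wpM2l ?divr_ge0 ?(ltW e0) // lerDl.
have H5 : enorm ((h - (T (xs + h) - xs)) *m (Hf (xs + h) - Hf xs)^T) <= e / 2 * enorm h.
  apply: le_trans (enorm_mulmx _ _) _; rewrite mx_l1_tr.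
  apply: le_trans (_ : e / 2 / (1 + k) * ((1 + k) * enorm h) <= _).
    apply: ler_pM; rewrite ?mx_l1_ge0 ?enorm_ge0 //.
    by apply: le_trans (enormB _ _) _; rewrite mulrDl mul1r lerD2l.
  by rewrite mulrA divfK ?gt_eqF.
lra.
Qed.

End Derivative.

End ForwardBackward.

(** * From criticality to the equivalence of the second-order conditions *)

Lemma critical_minorant (R : realType) (n : nat) (D : 'rV[R]_n -> 'rV[R]_n)
  (g : 'rV[R]_n -> \bar R) (gam : R) (xs : 'rV[R]_n) :
  0 < gam -> g xs \is a fin_num -> is_prox g gam (xs - gam *: D xs) xs ->
  forall u, ((fine (g xs) - dot (D xs) (u - xs) - enorm (u - xs) ^+ 2 / (2 * gam))%:E
    <= g u)%E.
Proof.
move=> gam0 gxs H u; have := H u.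
have -> : u - (xs - gam *: D xs) = (u - xs) + gam *: D xs by rewrite opprB addrCA addrC.
(* Both sides contain gam |D xs|^2 / 2 once the square is expanded; its cancellation leaves the
   linear and quadratic terms in u - xs. *)
rewrite subKr -{1}(fineK gxs) -EFinD -leeBlDr // -EFinB => K.
apply: le_trans K; rewrite lee_fin !enorm_sqr; move: (u - xs) => p.
rewrite !dot_linE (dotC p) invfM le_eqVlt; apply/orP; left; apply/eqP.
by field; rewrite gt_eqF.
Qed.

Theorem theorem3p8 (R : realType) (n : nat)
  (f : 'rV[R]_n -> R) (gradf : 'rV[R]_n -> 'rV[R]_n) (Lf : R)
  (g : 'rV[R]_n -> \bar R) (gam_g : R) (xs : 'rV[R]_n) :
  (* f differentiable with L_f-Lipschitz gradient *)
  (forall x, HasGradient f x (gradf x)) ->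
  (forall x y, enorm (gradf x - gradf y) <= Lf * enorm (x - y)) ->
  (* g proper, lsc, gam_g-prox-bounded *)
  proper_fun g -> lsc g -> 0 < gam_g -> prox_bounded g gam_g ->
  (* argmin (f + g) nonempty *)
  (exists xm, forall y, ((f xm)%:E + g xm <= (f y)%:E + g y)%E) ->
  (* xs critical *)
  critical gradf g gam_g xs ->
  (* Hessian of f exists and is continuous around xs *)
  (exists r : R, 0 < r /\ exists Hf : 'rV[R]_n -> 'M[R]_n,
     forall y, enorm (y - xs) < r -> HasDerivV gradf y (Hf y) /\ mx_continuous_at Hf y) ->
  (* g prox-regular and twice epi-differentiable at xs for -grad f(xs),
     with generalized quadratic second-order epi-derivative *)
  prox_regular g xs (- gradf xs) ->
  twice_epi_diff g xs (- gradf xs) ->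
  generalized_quadratic (d2 g xs (- gradf xs)) ->
  exists gbar : R, 0 < gbar /\
    forall gam : R, 0 < gam -> gam < gbar ->
      exists H : 'M[R]_n, hessian_at (FBE f gradf g gam) xs H /\
        ((forall s, (0 <= d2 (fun x => (f x)%:E + g x)%E xs 0 s)%E) <->
         (forall s, 0 <= dot (s *m H) s)) /\
        (sosp (fun x => (f x)%:E + g x)%E xs <-> sosp (FBE f gradf g gam) xs).
Proof.
move=> f_grad f_lip _ g_lsc _ _ _ [gam0 [gam0_gt0 [_ xs_prox]]].
move=> [rH [rH0 [Hf f_hess]]] [[gxs _] [r [e [r0 [e0 g_reg]]]]] g_epi [M [B g_d2]].
have g_min := critical_minorant gam0_gt0 gxs xs_prox.
(* No sign is assumed for [Lf]; its absolute value is a nonnegative Lipschitz constant. *)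
pose L := `|Lf|; have L0 : 0 <= L by exact: normr_ge0.
have f_lipL x y : enorm (gradf x - gradf y) <= L * enorm (x - y).
  by apply: le_trans (f_lip x y) _; rewrite ler_wpM2r ?enorm_ge0 // ler_norm.
have [|DA A_cont] := f_hess xs; first by rewrite subrr enorm0.
set A := Hf xs in DA.
have A_sym : forall h k, dot (h *m A) k = dot (k *m A) h.
  by apply: (hessian_symmetric (F := f) _ DA); exists 1.
have A_le u : dot (u *m A) u <= (L + 1) * dot u u.
  apply: le_trans (dot_ler _ _) _; rewrite -enorm_sqr expr2 mulrA.
  rewrite ler_wpM2r ?enorm_ge0 //.
  exact: derivative_bound (fun y => f_lipL y xs) DA u.
(* The first bound yields minimizers and coercivity, the second gam r < 1 for the Lipschitz
   estimate, the third gam (L + 1) < 1, where L + 1 bounds the form of [A]. The added 1 keeps the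
   inverses positive when [r] or [L] is 0. *)
exists (Num.min gam0 (Num.min (r + 1)^-1 (L + 1)^-1)).
split; first by rewrite !lt_min gam0_gt0 !invr_gt0 !ltr_wpDl.
move=> gam gam_gt0; rewrite !lt_min => /and3P[gam_lt gam_r gam_L].
have {}gam_r : gam * r < 1.
  move: gam_r; rewrite -[_^-1]div1r ltr_pdivlMr ?ltr_wpDl // mulrDr mulr1; lra.
have {}gam_L : gam * (L + 1) < 1.
  by move: gam_L; rewrite -[_^-1]div1r ltr_pdivlMr ?ltr_wpDl.
have gdiff : 0 < gam^-1 - gam0^-1 by rewrite subr_gt0 ltf_pV2.
have [T T_min] := choice (fb_argmin_exists f gam_gt0 gam_lt L0 f_lipL gxs g_min g_lsc).
have K_coercive u : (u <= B)%MS ->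
    (gam^-1 - gam0^-1) * dot u u <= dot (u *m symK gam M) u.
  exact: (symK_coercive gam gxs g_min g_d2).
have [P0 HP0] := constrained_solver gdiff K_coercive.
(* s P solves the stationarity equation of the model with right-hand side s (1 / gam - A); it is the
   minimizer, linear in [s]. *)
pose P := (gam^-1%:M - A) *m P0.
have HP s : (s *m P <= B)%MS /\ forall w, (w <= B)%MS ->
    dot (s *m P *m symK gam M) w = dot (s *m (gam^-1%:M - A)) w.
  by rewrite /P mulmxA; exact: HP0.
pose H := (1%:M - P) *m (gam^-1%:M - A^T).
pose G y := (y - T y) *m (gam^-1%:M - (Hf y)^T).
have DG : HasDerivV G xs H.
  exact: (fbgradient_derivative gam_gt0 gam_lt L0 f_lipL gxs g_min T_min DA g_epi g_d2 HP).
have Txs : T xs = xs := T_fixed gam_gt0 gam_lt L0 f_lipL gxs g_min T_min.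
have Gxs : G xs = 0 by rewrite /G Txs subrr mul0mx.
pose E := fbmin f gradf g gam T.
have FE : FBE f gradf g gam = fun x => (E x)%:E.
  by apply/funext => x; exact: (FBE_fbmin gxs g_min T_min).
have [d d0 [C C0 TC]] := T_lipschitz gam_gt0 gam_lt L0 f_lipL gxs g_min T_min e0 g_reg gam_r.
have gradE y : enorm (y - xs) < Num.min rH d -> HasGradient E y (G y).
  rewrite lt_min => /andP[/f_hess[Dy _] yd].
  (* The radius d - |y - xs| keeps y + h inside the ball where [T] is Lipschitz. *)
  apply: (fbmin_gradient gam_gt0 L0 f_lipL gxs g_min T_min (d := d - enorm (y - xs)) (C := C)) => //.
    by rewrite subr_gt0.
  move=> h hd; have := TC (y + h) y; rewrite [y + h - y]addrC addKr; apply=> //.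
  by rewrite -addrAC; apply: le_lt_trans (enormD _ _) _; rewrite -ltrBrDl.
have m0 : 0 < Num.min rH d by rewrite lt_min rH0.
have ET : Taylor2 E xs 0 H.
  by rewrite -Gxs; apply: taylor2 DG; exists (Num.min rH d).
have fT : Taylor2 f xs (gradf xs) A by apply: taylor2 DA; exists 1.
have d2E s : d2 (FBE f gradf g gam) xs 0 s = (dot (s *m H) s)%:E.
  by rewrite FE; exact: d2_finite.
have d2phi s : d2 (fun x => (f x)%:E + g x)%E xs 0 s =
    if (s <= B)%MS then (dot (s *m M) s + dot (s *m A) s)%:E else +oo%E.
  (* Writing 0 as gradf xs - gradf xs puts the sum in the form required by the sum rule. *)
  rewrite -(subrr (gradf xs)) (d2_add _ _ fT gxs) g_d2.
  by case: ifP => // _; rewrite -dot_mulmx.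
have equiv : (forall s, (0 <= d2 (fun x => (f x)%:E + g x)%E xs 0 s)%E) <->
    (forall s, 0 <= dot (s *m H) s).
  rewrite -(fbmodel_nonneg_iff gam_gt0 gam_L A_sym A_le _ HP); last first.
    by move=> u /K_coercive; apply: le_trans; rewrite mulr_ge0 ?dot_ge0 // ltW.
  split=> [K s sB|K s]; first by have := K s; rewrite d2phi sB lee_fin.
  by rewrite d2phi; case: ifP => // sB; rewrite lee_fin K.
exists H; split; last split=> //.
  exists (Num.min rH d); split=> //; exists G; split=> // y /gradE yG.
  by rewrite FE; split.
(* Both functions have 0 as a subgradient at [xs], so the two stationarity notions differ only in
   the curvature conditions compared by [equiv]. *)
have sub_phi : subgrad (fun x => (f x)%:E + g x)%E xs 0.
  apply: reg_subgrad_subgrad; rewrite -(subrr (gradf xs)).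
  apply: reg_subgrad_add => //.
  apply: (quadratic_minorant_subgrad (c := (2 * gam0)^-1) gxs) => y.
  by rewrite dotNl [_^-1 * _]mulrC; exact: g_min.
have sub_E : subgrad (FBE f gradf g gam) xs 0.
  rewrite FE; apply/reg_subgrad_subgrad/hasgradient_subgrad; rewrite -Gxs.
  by apply: gradE; rewrite subrr enorm0.
split=> -[_ [_ K]]; (split; [|split=> //]).
- by rewrite FE.
- by move=> s; rewrite d2E lee_fin; move: s; apply/equiv.
- by rewrite fin_numD gxs.
- by apply/equiv => s; have := K s; rewrite d2E lee_fin.
Qed.
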